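(* For an oriented virtual knot or link diagram $K$, the arrow polynomial $${\cal A}[K] = \sum_{S}\langle K|S\rangle\, d^{\,||S||-1}\, {\cal V}[S], \qquad d=-A^{2}-A^{-2},$$ is a polynomial in $A$, $A^{-1}$ and the graphical variables $K_{n}$, $n\ge 1$ (of which finitely many appear for any given virtual knot or link). ${\cal A}[K]$ is a regular isotopy invariant of virtual knots and links. The normalized version $${\cal W}[K] = (-A^{3})^{-wr(K)} {\cal A}[K]$$ is an invariant of virtual isotopy. If we set $A=1$ and $d=-A^{2}-A^{-2}=-2$, then the resulting specialization $${\cal F}[K] = {\cal A}[K](A=1)$$ is an invariant of flat virtual knots and links.
   Context: Virtual diagrams: a virtual link diagram is a generic immersion of circles in the plane each of whose double points is either a classical crossing (with over/under information) or a virtual crossing. Virtual isotopy is generated by planar isotopy, the classical Reidemeister moves I, II, III, and the detour move (an arc containing only virtual crossings may be replaced by any other generic arc with the same endpoints, all new intersections being declared virtual; this includes the virtual Reidemeister moves). Regular isotopy means the same relation without the classical first Reidemeister move. A flat virtual diagram has undecorated flat crossings in place of classical crossings; flat virtual knots and links are flat virtual diagrams up to the equivalence generated by planar isotopy, the Reidemeister moves on flat crossings (over/under ignored) and detour moves for virtual crossings. Each virtual diagram $K$ has an associated flat virtual diagram, obtained by forgetting the over/under information at its classical crossings. The writhe $wr(K)$ is the sum of the signs $\pm1$ of the classical crossings of the oriented diagram $K$. States: each classical crossing of the oriented diagram $K$ can be smoothed in two ways. In the oriented smoothing, each incoming edge is joined to an outgoing edge without crossing, consistently with orientation. In the disoriented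 smoothing, the two incoming edges are joined to each other and the two outgoing edges are joined to each other; each of these two joins is marked as a cusp (a vertex at which the two edge orientations both enter, or both leave). Each cusp is drawn as an acute angle; the side of the curve spanned by the acute angle is the inside of the cusp (so for the join of the two incoming edges the inside is the local region between those two incoming edges at the crossing, and similarly for the outgoing edges). At a positive crossing the oriented smoothing has weight $A$ and the disoriented one weight $A^{-1}$; at a negative crossing the oriented smoothing has weight $A^{-1}$ and the disoriented one weight $A$. A state $S$ is a choice of smoothing at every classical crossing; it is a collection of closed loops (which may cross each other and themselves at virtual crossings) carrying cusps. $\langle K|S\rangle$ is the product of the weights of the smoothings, and $||S||$ is the number of loops in $S$ (with or without cusps). Reduction: traversing a loop of a state in a chosen direction, each cusp has its inside locally to the left or to the right of the loop. Two cusps that are consecutive along the loop and have their insides on the same side are cancelled (deleted); consecutive cusps with insides on opposite sides are not cancelled. Virtual crossings play no role. Each loop carries an even number of cusps, and after all possible cancellations it has $2n$ cusps, $n\ge0$, alternating between the two sides; such a reduced loop contributes the variable $K_{n}$ if $n\ge 1$ and $1$ if $n=0$. ${\cal V}[S]$ is the product of these contributions over all loops of $S$. Here $K_1,K_2,\dots$ are independent commuting variables.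
   Formalization: The last claim fails under the flat first Reidemeister move (a kink changes F by −1: circle 1, kinked circle −1). Proved instead: F[K] is invariant under flat isotopy without that move, and (−1)^{wr(K)} F[K] is invariant under full flat isotopy. *)

(* Defs.v *)
From HB Require Import structures.
From Stdlib Require Import Relation_Operators.
From mathcomp Require Import all_boot all_order all_algebra.
From mathcomp Require Import finmap.
From mathcomp.multinomials Require Import monalg.

Set Implicit Arguments.
Unset Strict Implicit.
Unset Printing Implicit Defensive.

Import GRing.Theory.
Local Open Scope ring_scope.

(* Conventions.

   An oriented diagram is recorded, up to planar isotopy, as an oriented plane
   graph: its underlying 4-valent graph with the cyclic order of the edge-ends
   around every vertex.  Edges are named by natural numbers.  Besides classical
   (or flat) and virtual crossings there are bivalent vertices ("marks"), which
   carry no information: they subdivide an edge, give crossingless circles an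
   edge, and stand for the crossingless strands of the local pictures below. *)

(* The passage of a curve through a vertex: (incoming edge, outgoing edge). *)
Definition strand := (nat * nat)%type.

(* [Cross c p q] and [Virt p q] have, counterclockwise, the edge-ends
   p.1 (in), q.1 (in), p.2 (out), q.2 (out): the second strand crosses the first
   one from right to left.  Every transverse crossing of two oriented strands
   has this form for exactly one order of its strands.
   [C] is the decoration of the real crossings:
   - [bool] for virtual diagrams, [true] meaning that the first strand is over;
   - [unit] for flat virtual diagrams. *)
Inductive vertex (C : Type) :=
  | Cross of C & strand & strand
  | Virt of strand & strand
  | Mark of strand.
Arguments Virt {C} _ _.
Arguments Mark {C} _.

Section VertexEq.
Variable C : eqType.

Definition vertex_enc (v : vertex C) : C * strand * strand + strand * strand + strand :=
  match v with
  | Cross c p q => inl (inl (c, p, q))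
  | Virt p q => inl (inr (p, q))
  | Mark p => inr p
  end.

Definition vertex_dec (x : C * strand * strand + strand * strand + strand) : vertex C :=
  match x with
  | inl (inl (c, p, q)) => Cross c p q
  | inl (inr (p, q)) => Virt p q
  | inr p => Mark p
  end.

Lemma vertex_encK : cancel vertex_enc vertex_dec.
Proof. by case. Qed.

HB.instance Definition _ := Equality.copy (vertex C) (can_type vertex_encK).
End VertexEq.

Definition is_real (C : Type) (v : vertex C) : bool :=
  if v is Cross _ _ _ then true else false.

Definition strands_at (C : Type) (v : vertex C) : seq strand :=
  match v with
  | Cross _ p q | Virt p q => [:: p; q]
  | Mark p => [:: p]
  end.

Definition map_vertex (C C' : Type) (g : C -> C') (v : vertex C) : vertex C' :=
  match v with
  | Cross c p q => Cross (g c) p q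
  | Virt p q => Virt p q
  | Mark p => Mark p
  end.

Definition relabel (C : Type) (f : nat -> nat) (v : vertex C) : vertex C :=
  let r (p : strand) := (f p.1, f p.2) in
  match v with
  | Cross c p q => Cross c (r p) (r q)
  | Virt p q => Virt (r p) (r q)
  | Mark p => Mark (r p)
  end.

(* [(e, true)] is the head of the edge [e] (where it enters a vertex) and
   [(e, false)] is its tail. *)
Definition edge_end := (nat * bool)%type.

Definition flip (x : edge_end) : edge_end := (x.1, ~~ x.2).

Definition corners (C : Type) (v : vertex C) : seq edge_end :=
  match v with
  | Cross _ p q | Virt p q => [:: (p.1, true); (q.1, true); (p.2, false); (q.2, false)]
  | Mark p => [:: (p.1, true); (p.2, false)]
  end.

(* The orbit of [x] under [f], starting at [x], when it has at most [n] points. *)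
Definition orbit_upto (T : eqType) (f : T -> T) (n : nat) (x : T) : seq T :=
  let t := traject f (f x) n in x :: take (index x t) t.

(* Rotation systems: the lists of edge-ends around the vertices. *)
Section Rotation.
Variable r : seq (seq edge_end).

Definition heads : seq nat := [seq x.1 | x <- flatten r & x.2].
Definition tails : seq nat := [seq x.1 | x <- flatten r & ~~ x.2].

Definition each_edge_once : bool := uniq heads && perm_eq heads tails.

Definition rotate (x : edge_end) : edge_end :=
  foldr (fun c y => if x \in c then next c x else y) x r.

Definition n_faces : nat :=
  let s := flatten r in
  count (fun x => all (fun y => index x s <= index y s)%N
                      (orbit_upto (rotate \o flip) (size s) x)) s.

Definition n_components : nat :=
  n_comp (fun i j : 'I_(size r) =>
            has (fun x => x.1 \in [seq y.1 | y <- tnth (in_tuple r) j])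
                (tnth (in_tuple r) i)) predT.

(* Euler's formula, summed over the connected components: each of them lies on
   a sphere. *)
Definition planar : bool :=
  (size r + n_faces == size heads + n_components.*2)%N.

Definition plane_graph : bool := [&& r != [::], each_edge_once & planar].
End Rotation.

Record diagram (C : eqType) := Diagram {
  code :> seq (vertex C);
  codeP : plane_graph (map (@corners C) code)
}.

Definition vdiagram := diagram bool.
Definition fdiagram := diagram unit.

Definition forget (v : vertex bool) : vertex unit := map_vertex (fun=> tt) v.

Lemma forget_subproof (K : vdiagram) : plane_graph (map (@corners unit) (map forget K)).
Proof.
by rewrite -map_comp (eq_map (g := @corners bool)) ?codeP //; case.
Qed.

Definition flat (K : vdiagram) : fdiagram := Diagram (forget_subproof K).

Section Moves.
Variable C : eqType.
Implicit Types D E R : seq (vertex C).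

Definition edges D : seq nat := [seq p.1 | p <- flatten (map (@strands_at C) D)].

(* Planar isotopy: the names of the edges, the order in which the vertices are
   listed, and the marks are immaterial. *)
Variant renaming D D' : Prop :=
  Renaming f of {in edges D &, injective f} & perm_eq D' (map (relabel f) D).

Variant unmarking D D' : Prop :=
  Unmarking a b E of
    a != b & perm_eq D (Mark (a, b) :: E)
    & D' = map (relabel (fun x => if x == b then a else x)) E.

(* [over b] decorates a crossing whose over-strand is its first strand if [b],
   its second strand otherwise; for flat crossings it forgets [b]. *)
Variable over : bool -> C.

(* The strand [p] passes over the strand [q], which crosses [p] from right to
   left if [e], from left to right otherwise. *)
Definition over_under (e : bool) (p q : strand) : vertex C :=
  if e then Cross (over true) p q else Cross (over false) q p.

Definition local_move R R' D D' : Prop :=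
  exists E, perm_eq D (R ++ E) /\ perm_eq D' (R' ++ E).

(* A kink in the strand a0 -> a1 -> a2, over at its first passage if [o]. *)
Variant rmove1 D D' : Prop :=
  RMove1 (o e : bool) a0 a1 a2 of
    local_move
      [:: if o then over_under e (a0, a1) (a1, a2) else over_under e (a1, a2) (a0, a1)]
      [:: Mark (a0, a2)] D D'.

(* The strand a0 -> a1 -> a2 passes over the strand b0 -> b1 -> b2, the two
   strands bounding a bigon; they run in parallel directions iff [par]. *)
Variant rmove2 D D' : Prop :=
  RMove2 (e par : bool) a0 a1 a2 b0 b1 b2 of
    local_move
      [:: over_under e (a0, a1) (if par then (b0, b1) else (b1, b2));
          over_under (~~ e) (a1, a2) (if par then (b1, b2) else (b0, b1))]
      [:: Mark (a0, a2); Mark (b0, b2)] D D'.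

(* The triangle formed by a top strand a0 -> a1 -> a2, a middle strand
   b0 -> b1 -> b2 and a bottom strand c0 -> c1 -> c2.  The booleans eab, eac and
   ebc give the direction of crossing, as in [over_under]; all eight combinations
   occur.  For three oriented lines li = {x | det(ui, x) = ki}, the position of
   lj minus the position of lk along li is D / (det(ui, uj) det(ui, uk)), where
   D = k1 det(u2, u3) + k2 det(u3, u1) + k3 det(u1, u2) and (i, j, k) is a cyclic
   permutation of (1, 2, 3); [d] is the sign of D.  So the three directions and
   [d] determine the order of the crossings along each line, and moving one line
   across the crossing of the other two changes [d]. *)
Definition triangle (d eab eac ebc : bool) (a0 a1 a2 b0 b1 b2 c0 c1 c2 : nat) :
    seq (vertex C) :=
  let part (first : bool) x0 x1 x2 : strand := if first then (x0, x1) else (x1, x2) in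
  let ab_first_on_a := d (+) (eab == eac) in
  let ab_first_on_b := d (+) (eab == ebc) in
  let ac_first_on_c := d (+) (eac == ebc) in
  [:: over_under eab (part ab_first_on_a a0 a1 a2) (part ab_first_on_b b0 b1 b2);
      over_under eac (part (~~ ab_first_on_a) a0 a1 a2) (part ac_first_on_c c0 c1 c2);
      over_under ebc (part (~~ ab_first_on_b) b0 b1 b2) (part (~~ ac_first_on_c) c0 c1 c2)].

Variant rmove3 D D' : Prop :=
  RMove3 (eab eac ebc : bool) a0 a1 a2 b0 b1 b2 c0 c1 c2 of
    local_move (triangle true eab eac ebc a0 a1 a2 b0 b1 b2 c0 c1 c2)
               (triangle false eab eac ebc a0 a1 a2 b0 b1 b2 c0 c1 c2) D D'.

(* The strands of an arc running through the edges a, es_0, es_1, and so on. *)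
Definition arc (a : nat) (es : seq nat) : seq strand := zip (a :: es) es.

(* [R] consists of the virtual crossings on the arc [al] and of some marks; when
   the arc is erased, the strands [O] remain. *)
Definition virtual_arc (al O : seq strand) R : bool :=
  [&& al != [::], perm_eq (flatten (map (@strands_at C) R)) (al ++ O)
    & all (fun v => match v with
                    | Cross _ _ _ => false
                    | Virt p q => (p \in al) || (q \in al)
                    | Mark _ => true
                    end) R].

(* An arc from the edge [a] to the edge [b], all of whose crossings are virtual
   (including those with itself), is replaced by another one. *)
Variant detour D D' : Prop :=
  Detour a es es' O R R' of
    last a es = last a es'
    & virtual_arc (arc a es) O R & virtual_arc (arc a es') O R'
    & local_move R R' D D'.

Variant regular_move D D' : Prop :=
  | RegRenaming of renaming D D'
  | RegUnmarking of unmarking D D'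
  | RegDetour of detour D D'
  | RegR2 of rmove2 D D'
  | RegR3 of rmove3 D D'.

Variant any_move D D' : Prop :=
  | AnyRegular of regular_move D D'
  | AnyR1 of rmove1 D D'.
End Moves.

Definition regular_isotopic : vdiagram -> vdiagram -> Prop :=
  clos_refl_sym_trans vdiagram (fun K K' => regular_move id K K').

Definition virtually_isotopic : vdiagram -> vdiagram -> Prop :=
  clos_refl_sym_trans vdiagram (fun K K' => any_move id K K').

Definition flat_regular_isotopic : fdiagram -> fdiagram -> Prop :=
  clos_refl_sym_trans fdiagram (fun K K' => regular_move (fun=> tt) K K').

Definition flat_isotopic : fdiagram -> fdiagram -> Prop :=
  clos_refl_sym_trans fdiagram (fun K K' => any_move (fun=> tt) K K').

(* Laurent polynomials in one variable A over a commutative ring: the library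
   provides {malg R[int]} as a module; the product is convolution. *)
Section Laurent.
Variable R : comNzRingType.

Definition laurent := {malg R[int]}.
HB.instance Definition _ := GRing.Lmodule.on laurent.

Implicit Types g h : laurent.

Definition lmul g h : laurent :=
  \sum_(i <- msupp g) \sum_(j <- msupp h) << g@_i * h@_j *g (i + j)%R >>.

Lemma lmulw (d1 d2 : {fset int}) g h :
  (msupp g `<=` d1)%fset -> (msupp h `<=` d2)%fset ->
  lmul g h = \sum_(i <- d1) \sum_(j <- d2) << g@_i * h@_j *g (i + j)%R >>.
Proof.
move=> le1 le2; rewrite /lmul (big_fset_incl _ le1) /=.
  apply/eq_bigr=> i _; apply/big_fset_incl => // j _ /mcoeff_outdom ->.
  by rewrite mulr0 monalgU0.
move=> i _ /mcoeff_outdom gi.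
by rewrite big1 // => j _; rewrite gi mul0r monalgU0.
Qed.

Lemma lmulC : commutative lmul.
Proof.
move=> g h; rewrite /lmul exchange_big; apply/eq_bigr => i _.
by apply/eq_bigr => j _; rewrite mulrC addrC.
Qed.

Lemma lmul0 : left_zero 0 lmul.
Proof. by move=> g; rewrite /lmul msupp0 big_seq_fset0. Qed.

Lemma lmulDl : left_distributive lmul +%R.
Proof.
move=> g1 g2 g.
rewrite [in RHS](lmulw (fsubsetUl _ (msupp g2)) (fsubset_refl _)).
rewrite [in RHS](lmulw (fsubsetUr (msupp g1) _) (fsubset_refl _)).
rewrite (lmulw (msuppD_le _ _) (fsubset_refl _)).
rewrite -big_split /=; apply/eq_bigr=> i _.
rewrite -big_split /=; apply/eq_bigr=> j _.
by rewrite mcoeffD mulrDl monalgUD.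
Qed.

Lemma lmulDr : right_distributive lmul +%R.
Proof. by move=> g g1 g2; rewrite lmulC lmulDl !(lmulC g). Qed.

Lemma lmulUU x y i j : lmul << x *g i >> << y *g j >> = << x * y *g (i + j)%R >>.
Proof. by rewrite (lmulw msuppU_le msuppU_le) !big_seq_fset1 !mcoeffUU. Qed.

Lemma lmulEl g h : lmul g h = \sum_(i <- msupp g) lmul << g@_i *g i >> h.
Proof.
rewrite [in LHS](monalgE g).
exact: (big_morph (lmul^~ h) (fun _ _ => lmulDl _ _ _) (lmul0 _)).
Qed.

Lemma lmulEr g h : lmul g h = \sum_(i <- msupp h) lmul g << h@_i *g i >>.
Proof. by rewrite lmulC lmulEl; apply/eq_bigr => i _; rewrite lmulC. Qed.

Lemma lmulA : associative lmul.
Proof.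
move=> g1 g2 g3.
have lmul0r g : lmul g 0 = 0 by rewrite lmulC lmul0.
rewrite [LHS]lmulEl (lmulEl g1 g2).
rewrite [RHS](big_morph (lmul^~ _) (fun _ _ => lmulDl _ _ _) (lmul0 _)).
apply/eq_bigr=> i _; rewrite (lmulEl g2 g3) (lmulEr _ g2).
rewrite [LHS](big_morph (lmul _) (fun _ _ => lmulDr _ _ _) (lmul0r _)).
rewrite [RHS](big_morph (lmul^~ _) (fun _ _ => lmulDl _ _ _) (lmul0 _)).
apply/eq_bigr=> j _; rewrite [RHS]lmulEr (lmulEr _ g3).
rewrite [LHS](big_morph (lmul _) (fun _ _ => lmulDr _ _ _) (lmul0r _)).
by apply/eq_bigr=> k _; rewrite !lmulUU mulrA addrA.
Qed.

Lemma lmul1 : left_id << 0 >> lmul.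
Proof.
move=> g; rewrite lmulEr [RHS]monalgE.
by apply/eq_bigr=> i _; rewrite lmulUU mul1r add0r.
Qed.

Lemma laurent1_neq0 : (<< 0 >> : laurent) != 0.
Proof. by rewrite monalgU_eq0 oner_eq0. Qed.

HB.instance Definition _ := GRing.Zmodule_isComNzRing.Build laurent
  lmulA lmulC lmul1 lmulDl laurent1_neq0.

Definition lvar : laurent := << 1 >>.
Definition lvar_inv : laurent := << -1 >>.
Definition lconst (x : R) : laurent := << x *g 0 >>.

Lemma lvarK : lvar * lvar_inv = 1.
Proof. by rewrite [LHS]lmulUU mul1r. Qed.

(* The value at 1 of the variable. *)
Definition at_one (g : laurent) : R := \sum_(i <- msupp g) g@_i.
End Laurent.

(* A join connects two edge-ends.  [Some s] makes it a cusp whose inside is on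
   the right ([s = true]) or on the left ([s = false]) of a traveller going from
   the first end to the second one. *)
Definition join := (edge_end * edge_end * option bool)%type.

Definition straight (p : strand) : join := ((p.1, true), (p.2, false), None).

Section Loops.
Variables (D : seq (vertex bool)) (J : seq join).

(* Arriving at an edge-end: where to go, and which cusp is passed. *)
Definition passages : seq (edge_end * (edge_end * option bool)) :=
  flatten [seq [:: (j.1.1, (j.1.2, j.2)); (j.1.2, (j.1.1, omap negb j.2))] | j <- J].

Definition passage (x : edge_end) : edge_end * option bool :=
  head (x, None) [seq t.2 | t <- passages & t.1 == x].

(* [x] also stands for its edge travelled towards the end [x]. *)
Definition advance (x : edge_end) : edge_end := flip (passage x).1.

Definition loop_at (e : nat) : seq edge_end :=
  orbit_upto advance (size (edges D)).*2 (e, true).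

(* Every loop is listed once, starting with its smallest edge. *)
Definition loops : seq (seq edge_end) :=
  [seq loop_at e | e <- edges D & all (fun x => e <= x.1)%N (loop_at e)].

Definition cusps (l : seq edge_end) : seq bool := pmap (fun x => (passage x).2) l.
End Loops.

(* Cancellation of consecutive equal letters.  The resulting word alternates; if
   its length is even its two ends differ, so that it is also reduced as a
   cyclic word. *)
Definition reduce (w : seq bool) : seq bool :=
  foldr (fun c u => if u is c' :: u' then if c == c' then u' else c :: u else [:: c])
        [::] w.

(* The state sum in a commutative ring, for a = A, a' = A^-1 and k n = K_n. *)
Section StateSum.
Variables (T : comNzRingType) (a a' : T) (k : nat -> T).

(* The possible replacements of a vertex, with their weights: the oriented and
   the disoriented smoothing of a classical crossing, which is positive iff its
   first strand is over.  In the disoriented smoothing, going from p.1 to q.1 or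
   from p.2 to q.2 (each pair being counterclockwise consecutive) is a right
   turn. *)
Definition smoothings (v : vertex bool) : seq (T * seq join) :=
  match v with
  | Cross b p q =>
      [:: (if b then a else a', [:: straight (p.1, q.2); straight (q.1, p.2)]);
          (if b then a' else a, [:: ((p.1, true), (q.1, true), Some true);
                                    ((p.2, false), (q.2, false), Some true)])]
  | Virt p q => [:: (1, [:: straight p; straight q])]
  | Mark p => [:: (1, [:: straight p])]
  end.

Definition state := seq (T * seq join).

Definition states (D : seq (vertex bool)) : seq state :=
  foldr (fun v ss => [seq r :: s | r <- smoothings v, s <- ss]) [:: [::]] D.

Definition weight (S : state) : T := \prod_(r <- S) r.1.

Definition state_loops (D : seq (vertex bool)) (S : state) : seq (seq edge_end) :=
  loops D (flatten (map snd S)).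

Definition loop_variable (w : seq bool) : T :=
  let n := (size (reduce w))./2 in if n == 0%N then 1 else k n.

Definition state_variables (D : seq (vertex bool)) (S : state) : T :=
  \prod_(l <- state_loops D S) loop_variable (cusps (flatten (map snd S)) l).

(* Every state of a diagram has a loop, since a diagram has an edge. *)
Definition state_sum (D : seq (vertex bool)) : T :=
  let d := - a ^+ 2 - a' ^+ 2 in
  \sum_(S <- states D)
     weight S * d ^+ (size (state_loops D S)).-1 * state_variables D S.
End StateSum.

(* Z[K_1, K_2, ...]; the variable K_n is the generator of index n.-1. *)
Definition graphical_ring : comNzRingType := {malg int[{cmonom nat}]}.

Definition Kvar (n : nat) : graphical_ring := << ucm n.-1 >>.

Notation arrow_ring := (laurent graphical_ring).

Definition A_ : arrow_ring := lvar graphical_ring.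
Definition A_inv : arrow_ring := lvar_inv graphical_ring.

Definition arrow_polynomial (K : vdiagram) : arrow_ring :=
  state_sum A_ A_inv (fun n => lconst (Kvar n)) K.

Definition writhe (K : vdiagram) : int :=
  \sum_(v <- code K) if v is Cross b _ _ then (if b then 1 else -1) else 0.

(* u ^ n for an invertible u with inverse u'. *)
Definition unit_power (T : nzRingType) (u u' : T) (n : int) : T :=
  match n with Posz k => u ^+ k | Negz k => u' ^+ k.+1 end.

Definition normalized_arrow (K : vdiagram) : arrow_ring :=
  unit_power (- A_ ^+ 3) (- A_inv ^+ 3) (- writhe K) * arrow_polynomial K.

Definition flat_arrow (K : vdiagram) : graphical_ring := at_one (arrow_polynomial K).

(* Main.v *)
(* A state is a system of segments joining edge-ends.  Count the cusps of a
   segment with signs, so that reversing the segment negates its charge: cusps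
   on the same side which are consecutive along a loop have opposite signs, and
   a loop contributes K_n exactly when its total charge is 2n or -2n.  Charges
   are additive, so two segments meeting on an edge can be fused without
   changing the contribution of a state, and a local move is reduced to an
   identity between formal sums of systems of segments joining its outer ends,
   which is checked by computation for each of the finitely many pictures.  A
   state does not see the virtual crossings, so an arc with virtual crossings
   only is a single segment, wherever it runs.  At A = 1 the weights of the
   smoothings forget the over/under information. *)

From HB Require Import structures.
Require Import Defs.
From mathcomp Require Import all_boot all_order all_algebra.
From mathcomp Require Import finmap zify ring.
From mathcomp.multinomials Require Import monalg.

Set Implicit Arguments.
Unset Strict Implicit.
Unset Printing Implicit Defensive.

Import GRing.Theory.
Local Open Scope ring_scope.

(** The definition lists loops as orbits, ordered and directed by the names of edges, and a move
    disturbs these choices. The relation [tracing] admits every order, starting point and direction;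
    its uniqueness for balanced systems lets the loops be recomputed freely after a fusion. Local
    pictures are computed once, on distinct numbered edges, whereas in a diagram their outer edges
    may coincide. Fusion only uses that two segments meet, so it survives such identifications. A
    kink multiplies the state sum by [-A^3] or [-A^-3], hence by [-1] at [A = 1]. So the
    specialization is invariant under the flat moves other than the first one, and under all of them
    after multiplication by the sign [(-1)^writhe], which the flat diagram determines. A flat
    isotopy is not lifted as a whole: each move is lifted with its own choice of over and under, and
    the evaluation at [A = 1] joins the pieces. Normalization multiplies by a unit [+-A^m], so the
    same variables occur throughout a class of virtual isotopy. *)

(** * Tracing the loops of a system of segments *)

(* A segment from one edge-end to another, with its charge: the sum of
   the contributions of its cusps, which are counted with signs in such a way
   that reversing the segment negates the charge. *)
Definition segment := (edge_end * edge_end * int)%type.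

Definition source (j : segment) : edge_end := j.1.1.
Definition target (j : segment) : edge_end := j.1.2.
Definition back (j : segment) : segment := (target j, source j, - j.2).
(** Systems are compared through this multiset, so that neither the order of the segments nor the
    direction in which each is listed matters. *)
Definition twoway (J : seq segment) : seq segment := J ++ map back J.
Definition ends (J : seq segment) : seq edge_end := map source (twoway J).
(** Every edge that occurs has both of its ends occupied, each exactly once; the system therefore
    closes up into disjoint loops. *)
Definition balanced (J : seq segment) : bool :=
  uniq (ends J) && perm_eq (map flip (ends J)) (ends J).
Definition linked (j j' : segment) : bool := source j' == flip (target j).
Definition fuse (j j' : segment) : segment := (source j, target j', j.2 + j'.2).
Definition charge (l : seq segment) : int := \sum_(j <- l) j.2.
Definition closed_chain (l : seq segment) : bool := (l != [::]) && cycle linked l.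
Definition charges (L : seq (seq segment)) : seq nat := [seq `|charge l|%N | l <- L].

(** A loop is determined only up to rotation and reversal, and reversal negates its charge: hence a
    relation, with absolute charges taken as a multiset. *)
Variant tracing (J : seq segment) (mu : seq nat) : Prop :=
  Tracing L of all closed_chain L & perm_eq (twoway (flatten L)) (twoway J)
             & perm_eq mu (charges L).

Lemma uniq_map_inj (T T' : eqType) (f : T -> T') (s : seq T) :
  uniq (map f s) -> {in s &, injective f}.
Proof.
elim: s => //= z s IH /andP [nz u] x y; rewrite !inE.
move=> /predU1P [->|xs] /predU1P [->|ys] // e; last exact: IH.
  by rewrite e map_f in nz.
by rewrite -e map_f in nz.
Qed.

Lemma flipK : involutive flip.
Proof. by case=> e b; rewrite /flip /= negbK. Qed.

Lemma flip_neq x : flip x != x.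
Proof. by case: x => e []; rewrite /flip xpair_eqE /= andbF. Qed.

Lemma backK : involutive back.
Proof. by case=> [[x y] q]; rewrite /back opprK. Qed.

Ltac perm_count :=
  apply/permP => P;
  repeat match goal with H : is_true (perm_eq _ _) |- _ => move/permP/(_ P): H end;
  rewrite /ends /twoway /= ?map_cat ?flatten_cat ?map_cat ?count_cat /= ?map_cat ?count_cat /=
    ?backK; lia.

Lemma mem_twoway_back J j : (back j \in twoway J) = (j \in twoway J).
Proof.
rewrite /twoway !mem_cat (mem_map (can_inj backK)) orbC; congr (_ || _).
by rewrite -{2}(backK j) (mem_map (can_inj backK)).
Qed.

Lemma twoway_cat J1 J2 : perm_eq (twoway (J1 ++ J2)) (twoway J1 ++ twoway J2).
Proof. perm_count. Qed.

Lemma twoway_cons j J : perm_eq (twoway (j :: J)) (j :: back j :: twoway J).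
Proof. perm_count. Qed.

Lemma twoway_cons2 j J1 J2 :
  perm_eq (twoway (j :: J1)) (twoway (j :: J2)) = perm_eq (twoway J1) (twoway J2).
Proof. by rewrite (permPl (twoway_cons _ _)) (permPr (twoway_cons _ _)) !perm_cons. Qed.

Lemma perm_twoway J1 J2 : perm_eq J1 J2 -> perm_eq (twoway J1) (twoway J2).
Proof. by move=> e; apply: perm_cat => //; apply: perm_map. Qed.

Lemma perm_ends J1 J2 : perm_eq (twoway J1) (twoway J2) -> perm_eq (ends J1) (ends J2).
Proof. exact: perm_map. Qed.

Lemma ends_cat J1 J2 : perm_eq (ends (J1 ++ J2)) (ends J1 ++ ends J2).
Proof. perm_count. Qed.

Lemma perm_balanced J1 J2 : perm_eq (ends J1) (ends J2) -> balanced J1 = balanced J2.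
Proof.
move=> e; rewrite /balanced (perm_uniq e); congr (_ && _).
by rewrite (permPr e) (permPl (perm_map _ e)).
Qed.

Lemma twoway_rev_back J : perm_eq (twoway (rev (map back J))) (twoway J).
Proof.
apply/permP => P; rewrite /twoway map_rev !count_cat !count_rev.
by rewrite (mapK backK) addnC.
Qed.

Lemma charge_rev_back l : charge (rev (map back l)) = - charge l.
Proof.
by rewrite /charge (perm_big _ (permEl (perm_rev _))) big_map sumrN.
Qed.

Lemma closed_chain_rev_back l : closed_chain l -> closed_chain (rev (map back l)).
Proof.
case/andP=> l0 cl; apply/andP; split.
  by rewrite -size_eq0 size_rev size_map size_eq0.
rewrite rev_cycle cycle_map; apply: sub_cycle cl => i j /eqP h.
by apply/eqP; rewrite /source /target /= -/(source j) h flipK.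
Qed.

(** A closed chain may be rotated, and reversed if it runs through [j] backwards, without changing
    its absolute charge. *)
Lemma tracing_expose J mu j : tracing J mu -> j \in twoway J ->
  exists l L, [/\ all closed_chain ((j :: l) :: L),
     perm_eq (twoway (flatten ((j :: l) :: L))) (twoway J)
   & perm_eq mu (charges ((j :: l) :: L))].
Proof.
move=> [L cL eL emu] jJ.
have expose (i : segment) : i \in flatten L -> exists l L', [/\ all closed_chain ((i :: l) :: L'),
     perm_eq (twoway (flatten ((i :: l) :: L'))) (twoway J)
   & perm_eq mu (charges ((i :: l) :: L'))].
  case/flattenP=> l lL il.
  have [L1 [L2 eL']] : exists L1 L2, L = L1 ++ l :: L2.
    by case/splitPr: lL => L1 L2; exists L1, L2.
  case: (rot_to il) => n l' el.
  exists l', (L1 ++ L2); rewrite -el.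
  have pf : perm_eq (flatten (rot n l :: L1 ++ L2)) (flatten L).
    by rewrite eL' /= !flatten_cat /= perm_sym perm_catCA perm_cat2r perm_sym perm_rot.
  split.
  - move: cL; rewrite eL' /= !all_cat /= => /and3P [-> /andP [l0 cl] ->].
    by rewrite andbT /closed_chain rot_cycle cl -size_eq0 size_rot size_eq0 l0.
  - exact: perm_trans (perm_twoway pf) eL.
  - rewrite (perm_trans emu) // eL' /charges /= map_cat /=.
    rewrite /charge (perm_big _ (permEl (perm_rot n l))) /=.
    by apply/permP => P; rewrite /= !map_cat !count_cat /= addnCA.
move: jJ; rewrite -(perm_mem eL) mem_cat => /orP [|]; first exact: expose.
(* Here [j = back i]: the loop through [i] is reversed, which puts [j] last, and rotated by [size l]
   to put it first. *)
case/mapP=> i /expose [l [L' [cL' eL' emu']]] ->.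
have p1 : perm_eq (rot (size l) (rev (map back (i :: l)))) (rev (map back (i :: l))).
  by rewrite perm_rot.
have e1 : rot (size l) (rev (map back (i :: l))) = back i :: rev (map back l).
  by rewrite /= rev_cons -cats1 -(size_map back l) -size_rev rot_size_cat.
exists (rev (map back l)), L'; rewrite -e1.
have p2 := perm_trans (perm_twoway p1) (twoway_rev_back (i :: l)).
split.
- case/andP: cL' => cl cL'; apply/andP; split=> //; rewrite /closed_chain rot_cycle.
  case/andP: (closed_chain_rev_back cl) => h ->.
  by rewrite andbT -size_eq0 size_rot size_eq0.
- apply: perm_trans eL'; clear -p2.
  apply: (perm_trans (twoway_cat _ _)); rewrite perm_sym.
  apply: (perm_trans (twoway_cat _ _)); rewrite perm_sym.
  by rewrite perm_cat2r.
- apply: (perm_trans emu'); rewrite /charges /= /charge (perm_big _ p1) /=.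
  by rewrite -!/(charge _) (charge_rev_back (i :: l)) abszN.
Qed.

Lemma tracing_perm J1 J2 mu : perm_eq (twoway J1) (twoway J2) -> tracing J1 mu -> tracing J2 mu.
Proof. by move=> e [L cL eL emu]; exists L => //; apply: perm_trans e. Qed.

Lemma charge_cons j l : charge (j :: l) = j.2 + charge l.
Proof. by rewrite /charge big_cons. Qed.

Lemma closed_chain_fuse j1 j2 l : linked j1 j2 ->
  closed_chain (fuse j1 j2 :: l) = closed_chain (j1 :: j2 :: l).
Proof.
move=> l12; rewrite /closed_chain /= l12 /=.
by case: l => [|j l] /=; rewrite /linked /source /target /= ?andbT ?rcons_path.
Qed.

Lemma tracing_fuse j1 j2 J mu : linked j1 j2 ->
  tracing (fuse j1 j2 :: J) mu -> tracing (j1 :: j2 :: J) mu.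
Proof.
move=> l12 tr.
have [|l [L [cL eL emu]]] := tracing_expose (j := fuse j1 j2) tr.
  by rewrite mem_cat inE eqxx.
exists ((j1 :: j2 :: l) :: L).
- by move: cL; rewrite [in X in X -> _]/= closed_chain_fuse.
- by rewrite /= !twoway_cons2; move: eL; rewrite /= twoway_cons2.
- by rewrite (perm_trans emu) // /charges /= !charge_cons addrA.
Qed.

Lemma tracing_loop j J mu : target j = flip (source j) ->
  tracing J mu -> tracing (j :: J) (`|j.2|%N :: mu).
Proof.
move=> ej [L cL eL emu]; exists ([:: j] :: L).
- by rewrite /= cL andbT /closed_chain /= /linked ej flipK eqxx.
- perm_count.
- by rewrite /charges /= charge_cons /charge big_nil addr0 perm_cons.
Qed.

(** * Existence and uniqueness of the tracing *)

(* Junk value [j] if no segment of [J] follows [j]. *)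
Definition successor (J : seq segment) (j : segment) : segment :=
  head j [seq i <- twoway J | linked j i].

Definition discard (J : seq segment) (j : segment) : seq segment :=
  [seq i <- J | (i != j) && (i != back j)].

(* The absolute charges of the loops of a balanced system; [n] is fuel, to be
   taken equal to [size J]. *)
Fixpoint trace (n : nat) (J : seq segment) : seq nat :=
  if n isn't n'.+1 then [::] else
  if J isn't j :: J' then [::] else
  if target j == flip (source j) then `|j.2|%N :: trace n' J'
  else let i := successor J' j in trace n' (fuse j i :: discard J' i).

Lemma ends_cons j J : perm_eq (ends (j :: J)) (source j :: target j :: ends J).
Proof. by have := perm_map source (twoway_cons j J). Qed.

Lemma count_ends_cons P j J :
  count P (ends (j :: J)) = (P (source j) + (P (target j) + count P (ends J)))%N.
Proof. by move/permP: (ends_cons j J) => ->. Qed.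

Lemma uniq_ends_cons j J : uniq (ends (j :: J)) =
  [&& source j \notin target j :: ends J, target j \notin ends J & uniq (ends J)].
Proof. exact: perm_uniq (ends_cons j J). Qed.

Lemma mem_endsP J x : reflect (exists2 j, j \in twoway J & source j = x) (x \in ends J).
Proof. by apply: (iffP mapP) => [[j]|[j]] h e; exists j. Qed.

Lemma source_inj J : uniq (ends J) -> {in twoway J &, injective source}.
Proof. by move=> u i j iJ jJ e; exact: (uniq_map_inj u). Qed.

Lemma balanced_fuse j1 j2 J : linked j1 j2 ->
  balanced (j1 :: j2 :: J) -> balanced (fuse j1 j2 :: J).
Proof.
case: j1 j2 => [[x y] q] [[y' z] q'] /eqP; rewrite /source /target /= => -> {y'}.
(* The same ends regrouped: a closed segment on the edge where the two segments meet, which can be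
   removed, and the fused segment. *)
rewrite (@perm_balanced _ ((y, flip y, 0) :: (x, z, q + q') :: J)); last first.
  by apply/permP => P; rewrite !count_ends_cons /source /target /=; lia.
rewrite /balanced => /andP [u p]; apply/andP; split.
  by rewrite uniq_ends_cons in u; case/and3P: u.
have p' := ends_cons (y, flip y, 0) ((x, z, q + q') :: J).
move: p; rewrite (permPl (perm_map _ p')) (permPr p') /= /source /target /= flipK.
move=> p; rewrite -(perm_cons y) -(perm_cons (flip y)); apply: perm_trans p _.
by apply/permP => P /=; rewrite addnCA.
Qed.

Lemma balanced_loop j J : target j = flip (source j) -> balanced (j :: J) -> balanced J.
Proof.
move=> ej /andP [u p]; apply/andP; split.
  by rewrite uniq_ends_cons in u; case/and3P: u.
have p' := ends_cons j J.
move: p; rewrite (permPl (perm_map _ p')) (permPr p') /= ej flipK.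
move=> p; rewrite -(perm_cons (source j)) -(perm_cons (flip (source j))).
by apply: perm_trans p _; apply/permP => P /=; rewrite addnCA.
Qed.

Lemma uniq_ends_twoway J : uniq (ends J) -> uniq (twoway J).
Proof. exact: map_uniq. Qed.

(** Distinct ends exclude that [J] contains a segment twice or together with its reverse, so exactly
    one segment is discarded. *)
Lemma perm_discard J i : uniq (ends J) -> i \in twoway J ->
  perm_eq (twoway J) (twoway (i :: discard J i)).
Proof.
move=> u iJ.
wlog iJ' : i iJ / i \in J.
  move=> H; move: (iJ); rewrite mem_cat => /orP [iJ'|]; first exact: H.
  case/mapP=> k kJ ek; have := H k; rewrite mem_cat kJ => /(_ isT isT) h.
  have -> : discard J i = discard J k.
    by apply: eq_filter => m; rewrite ek backK andbC.
  by apply: (perm_trans h); rewrite ek; perm_count.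
have uJ : uniq J by have := uniq_ends_twoway u; rewrite cat_uniq => /and3P [].
have : perm_eq J (i :: [seq k <- J | k != i]) by rewrite -rem_filter ?perm_to_rem.
suff -> : [seq k <- J | k != i] = discard J i by exact: perm_twoway.
apply: eq_in_filter => k kJ; case: eqVneq => //= ki; apply/esym/negP => /eqP ek.
have := uniq_ends_twoway u; rewrite cat_uniq => /and3P [_ /hasPn /(_ k) + _].
by rewrite kJ => /(_ _)/negP []//; rewrite ek map_f.
Qed.

Lemma balanced_ends_cons j J : balanced (j :: J) -> [/\ uniq (ends J), source j \notin ends J,
  target j \notin ends J, source j != target j
  & forall x, flip x \in ends (j :: J) = (x \in ends (j :: J))].
Proof.
case/andP => u p; move: (u); rewrite uniq_ends_cons inE negb_or.
case/and3P => [/andP [h1 h2] h3 ->]; split=> // x.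
by rewrite -(perm_mem p) (mem_map (can_inj flipK)).
Qed.

Lemma successorP j J : balanced (j :: J) -> target j != flip (source j) ->
  successor J j \in twoway J /\ linked j (successor J j).
Proof.
move=> bJ ne; case: (balanced_ends_cons bJ) => u sj tj st fl.
have: flip (target j) \in ends J.
  have := fl (target j); rewrite !(perm_mem (ends_cons _ _)) !inE eqxx orbT.
  by rewrite (negPf (flip_neq _)) /= (can2_eq flipK flipK) (negPf ne).
case/mem_endsP => i iJ ei.
have: i \in [seq i <- twoway J | linked j i] by rewrite mem_filter iJ /linked ei eqxx.
rewrite /successor; case E: [seq i <- twoway J | linked j i] => [//|k s] _ /=.
have : k \in [seq i <- twoway J | linked j i] by rewrite E inE eqxx.
by rewrite mem_filter => /andP [].
Qed.

Lemma successor_uniq j i J : balanced (j :: J) -> i \in twoway J -> linked j i ->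
  target j != flip (source j) /\ successor J j = i.
Proof.
move=> bJ iJ /eqP ji; case: (balanced_ends_cons bJ) => u sj tj st fl.
have ne : target j != flip (source j).
  apply: contra sj => /eqP e; apply/mem_endsP; exists i => //.
  by rewrite ji e flipK.
split=> //; have [h /eqP h'] := successorP bJ ne.
by apply: (source_inj u) => //; rewrite h' ji.
Qed.

Lemma perm_cons_discard j i J : balanced (j :: J) -> i \in twoway J ->
  perm_eq (twoway (j :: J)) (twoway (j :: i :: discard J i)).
Proof.
move=> bJ iJ; case: (balanced_ends_cons bJ) => u _ _ _ _.
by rewrite twoway_cons2; exact: perm_discard.
Qed.

Lemma size_discard J i : uniq (ends J) -> i \in twoway J -> size J = (size (discard J i)).+1.
Proof.
by move=> u /(perm_discard u)/perm_size; rewrite /twoway !size_cat !size_map !addnn => /double_inj.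
Qed.

Lemma trace_exists n J : size J = n -> balanced J -> tracing J (trace n J).
Proof.
elim: n J => [|n IH] [|j J] //= => [_ _|[sJ] bJ]; first by exists [::].
case: eqP => [ej|/eqP ne]; first by apply: tracing_loop => //; apply/IH/(balanced_loop ej).
have [iJ ji] := successorP bJ ne; have [u _ _ _ _] := balanced_ends_cons bJ.
set i := successor J j in iJ ji *.
have p := perm_cons_discard bJ iJ.
apply: (@tracing_perm (j :: i :: discard J i)); first by rewrite perm_sym.
apply: (tracing_fuse ji).
apply: IH; first by rewrite /= -(size_discard u iJ).
by apply: balanced_fuse => //; rewrite -(perm_balanced (perm_ends p)).
Qed.

(** The sources of a balanced system are distinct, so the segment that follows [j] in any tracing is
    forced to be its successor. Fusing the two turns the tracing into one of the system that [trace]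
    treats next. *)
Lemma tracing_unique n J mu : size J = n -> balanced J -> tracing J mu -> perm_eq mu (trace n J).
Proof.
elim: n J mu => [|n IH] [|j J] //= mu.
  move=> _ _ [[|[|j l] L] //= _ /perm_size]; by rewrite /twoway size_cat.
move=> [sJ] bJ tr; have [u _ _ _ _] := balanced_ends_cons bJ.
have [|[|i l] [L [/andP[cl cL] eL emu]]] := tracing_expose (j := j) tr.
- by rewrite mem_cat inE eqxx.
- move: cl; rewrite /closed_chain /= andbT /linked => /eqP ej.
  have ej' : target j = flip (source j) by rewrite ej flipK.
  rewrite ej' eqxx (perm_trans emu) // /charges /= charge_cons /charge big_nil addr0.
  rewrite perm_cons; apply: IH => //; first exact: (balanced_loop ej').
  by exists L => //; rewrite -(twoway_cons2 j).
- have ji : linked j i by move: cl; rewrite /closed_chain /= => /andP [].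
  have p1 : perm_eq (twoway (i :: l ++ flatten L)) (twoway J).
    by rewrite -(twoway_cons2 j).
  have iJ : i \in twoway J by rewrite -(perm_mem p1) mem_cat inE eqxx.
  have [ne ei] := successor_uniq bJ iJ ji; rewrite (negPf ne) ei.
  have p := perm_cons_discard bJ iJ.
  apply: IH; first by rewrite /= -(size_discard u iJ).
    by apply: balanced_fuse => //; rewrite -(perm_balanced (perm_ends p)).
  exists ((fuse j i :: l) :: L).
  + by apply/andP; split; rewrite ?closed_chain_fuse.
  + have := perm_trans (y := twoway J) p1 (perm_discard u iJ).
    by rewrite /= !twoway_cons2.
  + by rewrite (perm_trans emu) // /charges /= !charge_cons addrA.
Qed.

(** * The loops of a state *)

Lemma source_neq_target J j : uniq (ends J) -> j \in twoway J -> source j != target j.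
Proof.
move=> u jJ; have := perm_uniq (perm_ends (perm_discard u jJ)).
by rewrite u uniq_ends_cons inE negb_or => /esym /andP [/andP []].
Qed.

Lemma map_fcycle (T : eqType) (f : T -> T) (l : seq T) : fcycle f l -> map f l = rot 1 l.
Proof.
case: l => //= x p; rewrite rot1_cons; move: {2 4}x => y.
by elim: p x => [|z p IH] x /= /andP [/eqP -> //]; move=> /IH <-.
Qed.

Lemma uniq_flatten_map (S T : eqType) (g : S -> seq T) (s : seq S) :
  uniq s -> {in s, forall i, uniq (g i)} ->
  {in s &, forall i j z, z \in g i -> z \in g j -> i = j} -> uniq (flatten (map g s)).
Proof.
elim: s => //= i s IH /andP [si us] ug dg; rewrite cat_uniq ug ?inE ?eqxx //=.
rewrite IH //; first last.
- by move=> j k js ks; apply: dg; rewrite inE ?js ?ks orbT.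
- by move=> j js; apply: ug; rewrite inE js orbT.
rewrite andbT; apply/hasPn => z /flatten_mapP [j js zj]; apply/negP => zi.
have eij : i = j by apply: (dg _ _ _ _ z); rewrite ?inE ?eqxx ?js ?orbT.
by rewrite eij js in si.
Qed.

(** * Orbits of an injective map on a finite set *)

Section Orbits.
Variables (T : eqType) (X : seq T) (f : T -> T).
Hypotheses (fX : {in X, forall x, f x \in X}) (f_inj : {in X &, injective f}).

Lemma iter_in n x : x \in X -> iter n f x \in X.
Proof. by move=> xX; elim: n => //= n; apply: fX. Qed.

Lemma iter_cancel a b x : x \in X -> iter a f x = iter (a + b) f x -> iter b f x = x.
Proof.
move=> xX; elim: a => [|a IH] //= e; apply: IH.
by apply: f_inj => //; apply: iter_in.
Qed.

Lemma iter_return x : x \in X -> exists2 n, (0 < n <= size X)%N & iter n f x = x.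
Proof.
move=> xX; have: looping f x (size X).
  rewrite -[looping _ _ _]negbK -looping_uniq; apply/negP => u.
  have /(uniq_leq_size u) : {subset traject f x (size X).+1 <= X}.
    by move=> y /trajectP [i _ ->]; apply: iter_in.
  by rewrite size_traject ltnn.
case/trajectP => a ha e; exists (size X - a)%N; first by rewrite subn_gt0 ha leq_subr.
by apply: (@iter_cancel a) => //; rewrite subnKC // ltnW.
Qed.

Variable n : nat.
Hypothesis sizeX : (size X <= n)%N.

(** The first return to [x] occurs within [size X <= n] steps, so the bound in [orbit_upto] cuts
    nothing off. *)
Lemma orbit_uptoP x : x \in X ->
  let l := orbit_upto f n x in
  [/\ uniq l, fcycle f l & forall y, (y \in l) <-> (exists i, y = iter i f x)].
Proof.
move=> xX l.
have [i [hi e ilt]] : exists i, [/\ l = traject f x i.+1, iter i.+1 f x = x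
    & forall j, (0 < j <= i)%N -> iter j f x != x].
  (* The trajectory starts at [f x], so this index is the period minus one. *)
  exists (index x (traject f (f x) n)).
  have xt : x \in traject f (f x) n.
    have [m /andP [m0 mX] em] := iter_return xX.
    apply/trajectP; exists m.-1; first by rewrite prednK // (leq_trans mX).
    by rewrite -iterSr prednK.
  have it := xt; rewrite -index_mem size_traject in it.
  split.
  - by rewrite /l /orbit_upto /= take_traject // ltnW.
  - by rewrite iterSr -(nth_traject f it) nth_index.
  - move=> [|j] // /andP [_ ji]; have := @before_find _ x (pred1 x) (traject f (f x) n) j ji.
    rewrite (set_nth_default (f x)) ?size_traject ?(ltn_trans ji) //.
    by rewrite nth_traject ?(ltn_trans ji) //= -iterSr => ->.
have cl : fcycle f l.
  rewrite hi /= -[X in rcons _ X]e -[traject _ _ i]/(traject f (f x) i).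
  by rewrite iterSr -trajectSr fpath_traject.
split=> //.
- rewrite hi looping_uniq; apply/negP => /trajectP [a ai ea].
  have h : iter (i - a) f x = x by apply: (@iter_cancel a) => //; rewrite subnKC // ltnW.
  by have := ilt (i - a)%N; rewrite subn_gt0 ai leq_subr h eqxx => /(_ isT).
- move=> y; split=> [|[j ->]].
    by rewrite hi => /trajectP [j _ ->]; exists j.
  elim: j => [|j IH] /=; first by rewrite hi mem_head.
  exact: mem_fcycle cl _ IH.
Qed.

End Orbits.

Definition sign (b : bool) : int := if b then 1 else -1.

Lemma signN b : sign (~~ b) = - sign b.
Proof. by case: b. Qed.

(** Heads and tails alternate at the successive cusps of a loop. The factor [sign j.1.1.2] thus
    turns the alternating sum of the sides into a plain sum; reversal keeps this factor and
    exchanges the sides, so it negates the charge. *)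
Definition join_segment (j : join) : segment :=
  (j.1.1, j.1.2, if j.2 is Some s then sign j.1.1.2 * sign s else 0).

(* Both the two incoming and the two outgoing edges meet at a cusp. *)
Definition coherent (j : join) : bool := (j.2 == None) == (j.1.1.2 != j.1.2.2).

Definition join_back (j : join) : join := (j.1.2, j.1.1, omap negb j.2).

Lemma join_segment_back j : coherent j -> join_segment (join_back j) = back (join_segment j).
Proof.
case: j => [[[e b] [e' b']] [s|]]; rewrite /coherent /back /join_segment /=.
  by case: b b' s => [] [] [].
by rewrite oppr0.
Qed.

(* The alternating sum of the letters is invariant under cancellation, and
   every letter of an alternating word contributes the same sign. *)
Definition rotation (w : seq bool) : int := foldr (fun c r => sign c - r) 0 w.

Lemma size_reduce w : size (reduce w) = `|rotation w|%N.
Proof.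
(* Strengthened for the induction: the reduced word alternates, and its first letter gives the sign
   of the alternating sum. *)
have [-> _] : rotation w = (if reduce w is c :: u then sign c * (size u).+1%:Z else 0)
    /\ sorted (fun b c => b != c) (reduce w).
  elim: w => //= c w [-> alt]; case: (reduce w) alt => [|c' u] /=.
    by rewrite subr0 mulr1.
  case: (eqVneq c c') => [-> | ne] alt /=; last first.
    have e : c' = ~~ c by move: ne; case: (c); case: (c').
    subst c'.
    by split; [rewrite signN; lia | rewrite alt; case: (c)].
  case: u alt => [|c'' u] /=; first by rewrite mulr1 subrr.
  case/andP=> ne ->; split=> //.
  have -> : c'' = ~~ c' by move: ne; case: (c'); case: (c'').
  by rewrite signN; lia.
by case: (reduce w) => [|c u] //; rewrite abszM; case: c; rewrite mul1n.
Qed.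

(** * The listed loops form a tracing *)

Section StateLoops.
Variables (D : seq (vertex bool)) (J : seq join).
Hypothesis coh : all coherent J.

Lemma perm_passages : perm_eq (twoway (map join_segment J))
  [seq join_segment (t.1, t.2.1, t.2.2) | t <- passages J].
Proof.
rewrite /passages; elim: J coh => //= j J' IH /andP [cj /IH p].
rewrite (permPl (twoway_cons _ _)) -join_segment_back //= perm_cons.
by case: j {cj} => [[x y] c]; rewrite /join_back /= perm_cons.
Qed.

Let X := ends (map join_segment J).
Hypothesis bal : balanced (map join_segment J).

Lemma perm_passage_sources : perm_eq X [seq t.1 | t <- passages J].
Proof.
have := perm_map source perm_passages; rewrite -map_comp => p.
by apply: (perm_trans p); apply/permP=> P; rewrite (eq_map (g := fst)).
Qed.

Let seg (x : edge_end) : segment := join_segment (x, (passage J x).1, (passage J x).2).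

Lemma passageP t : t \in passages J -> passage J t.1 = t.2.
Proof.
have: uniq [seq t.1 | t <- passages J].
  by rewrite -(perm_uniq perm_passage_sources); case/andP: bal.
rewrite /passage; elim: (passages J) => //= t' s IH /andP [nt us].
rewrite inE => /predU1P [->|ts] /=; first by rewrite eqxx.
case: eqP => [e|_]; last exact: IH.
by rewrite e map_f in nt.
Qed.

Lemma perm_segs : perm_eq (map seg X) (twoway (map join_segment J)).
Proof.
rewrite (permPr perm_passages) (permPl (perm_map _ perm_passage_sources)) -map_comp.
suff -> : map (seg \o fst) (passages J) =
  [seq join_segment (t.1, t.2.1, t.2.2) | t <- passages J] by [].
by apply/eq_in_map => t ts /=; rewrite /seg passageP.
Qed.

Lemma mem_flip x : (flip x \in X) = (x \in X).
Proof. by case/andP: bal => _ p; rewrite -(perm_mem p) (mem_map (can_inj flipK)). Qed.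

Let mate (x : edge_end) : edge_end := (passage J x).1.

Lemma mate_in x : x \in X -> [/\ mate x \in X, mate (mate x) = x, mate x != x & seg (mate x) = back (seg x)].
Proof.
move=> xX; have sx : seg x \in twoway (map join_segment J) by rewrite -(perm_mem perm_segs) map_f.
have: back (seg x) \in map seg X by rewrite (perm_mem perm_segs) mem_twoway_back.
case/mapP => y yX ey.
have emy : mate x = y by have [] := congr1 source ey.
have ex : mate y = x by have [] := congr1 target ey.
rewrite emy; split=> //; apply: contraTneq sx => eyx.
apply/negP => /source_neq_target; rewrite /source /target /= -/(mate x) emy eyx eqxx.
by case/andP: bal => u _ /(_ u).
Qed.

Let adv (x : edge_end) : edge_end := advance J x.

Lemma adv_in : {in X, forall x, adv x \in X}.
Proof. by move=> x xX; rewrite mem_flip; have [] := mate_in xX. Qed.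

Lemma adv_inj : {in X &, injective adv}.
Proof.
move=> x y xX yX /(can_inj flipK) e; have {}e : mate x = mate y by [].
by have [_ <- _ _] := mate_in xX; have [_ <- _ _] := mate_in yX; rewrite e.
Qed.

(** Turning round reverses the travel: [flip] conjugates [adv] to its inverse. *)
Lemma adv_flip_adv x : x \in X -> adv (flip (adv x)) = flip x.
Proof.
move=> xX; rewrite /adv /advance flipK -/(mate x) -/(mate (mate x)).
by have [_ -> _ _] := mate_in xX.
Qed.

Definition reach (x y : edge_end) : Prop := exists i, y = iter i adv x.

Lemma reach_in x y : x \in X -> reach x y -> y \in X.
Proof. by move=> xX [i ->]; apply: iter_in adv_in _ _ _. Qed.

Lemma reach_trans x y z : reach x y -> reach y z -> reach x z.
Proof. by move=> [i ->] [j ->]; exists (j + i)%N; rewrite iterD. Qed.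

Lemma reach_sym x y : x \in X -> reach x y -> reach y x.
Proof.
move=> xX [i ->]; elim: i => [|i IH]; first by exists 0%N.
have yX := iter_in adv_in i xX; have [[|m] // _ em] := iter_return adv_in adv_inj yX.
by apply: reach_trans IH; exists m; rewrite iterS -iterSr em.
Qed.

Lemma reach_flip x y : x \in X -> reach x y -> reach (flip x) (flip y).
Proof.
move=> xX [i ->]; elim: i => [|i IH]; first by exists 0%N.
apply: reach_trans IH _; have yX := iter_in adv_in i xX.
apply: reach_sym; first by rewrite mem_flip; apply: adv_in.
by exists 1%N; rewrite /= adv_flip_adv.
Qed.

(* A path from an edge to its reverse could be shortened at both ends. *)
Lemma reach_flipF x : x \in X -> ~ reach x (flip x).
Proof.
move=> xX [i]; elim/ltn_ind: i x xX => [[|[|i]]] IH x xX e.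
- by have := flip_neq x; rewrite e eqxx.
- have [_ _ /negP nm _] := mate_in xX; apply: nm; apply/eqP.
  by apply: (can_inj flipK); exact: esym e.
- apply: (IH i _ (adv x)) => //; first exact: adv_in.
  apply: adv_inj; first by rewrite mem_flip; apply: adv_in.
    by apply: iter_in adv_in _ _ _; apply: adv_in.
  by rewrite adv_flip_adv // e -iterSr.
Qed.

Hypothesis ends_D : perm_eq X ([seq (e, true) | e <- edges D] ++ [seq (e, false) | e <- edges D]).

Lemma size_X : size X = (size (edges D)).*2.
Proof. by rewrite (perm_size ends_D) size_cat !size_map addnn. Qed.

Lemma mem_X x : (x \in X) = (x.1 \in edges D).
Proof.
case: x => e b; rewrite (perm_mem ends_D) mem_cat /=; apply/orP/idP.
  by case=> /mapP [e' he [->]].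
by case: b => he; [left | right]; rewrite map_f.
Qed.

Lemma loop_atP e : e \in edges D ->
  [/\ uniq (loop_at D J e), fcycle adv (loop_at D J e)
    & forall y, (y \in loop_at D J e) <-> reach (e, true) y].
Proof.
move=> he; apply: (orbit_uptoP adv_in adv_inj); first by rewrite size_X.
by rewrite mem_X.
Qed.

Lemma uniq_edges : uniq (edges D).
Proof.
by case/andP: bal => + _; rewrite (perm_uniq ends_D) cat_uniq => /andP [/map_uniq].
Qed.

(** A loop without direction consists of two orbits of [adv], exchanged by [flip]. *)
Definition same_loop (x y : edge_end) : Prop := reach x y \/ reach x (flip y).

Lemma loop_at_edges e z : e \in edges D ->
  (z \in [seq x.1 | x <- loop_at D J e]) <-> same_loop (e, true) (z, true).
Proof.
move=> he; have [_ _ mem] := loop_atP he; split.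
  by case/mapP => [[z' []]] /mem h /= ->; [left | right].
by case=> /mem h; [exact: (map_f fst h) | exact: (map_f fst h)].
Qed.

Lemma same_loop_sym x y : x \in X -> same_loop x y -> same_loop y x.
Proof.
move=> xX [] h; [left | right]; first exact: reach_sym.
by rewrite -(flipK y); apply: reach_flip; [exact: reach_in h | exact: reach_sym].
Qed.

Lemma same_loop_trans x y z : x \in X -> same_loop x y -> same_loop y z -> same_loop x z.
Proof.
move=> xX [] h; have hX := reach_in xX h; move=> [] h'.
- by left; apply: reach_trans h'.
- by right; apply: reach_trans h'.
- by right; apply: (reach_trans h); apply: reach_flip h'; rewrite -mem_flip.
- left; apply: (reach_trans h); rewrite -(flipK z); apply: reach_flip h'.
  by rewrite -mem_flip.
Qed.

(** By [reach_flipF] an orbit meets an edge in one direction only, and the minimality of the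
    starting edge selects one representative in each class of [same_loop]. *)
Lemma perm_loops_edges : perm_eq [seq x.1 | x <- flatten (loops D J)] (edges D).
Proof.
have edX e : e \in edges D -> (e, true) \in X by rewrite mem_X.
have leE e : e \in edges D -> all (fun x => e <= x.1)%N (loop_at D J e) <->
    forall z, same_loop (e, true) (z, true) -> (e <= z)%N.
  move=> he; split=> [/allP h z /(loop_at_edges _ he) /mapP [x /h + ->] //|h].
  by apply/allP => x xl; apply/h/(loop_at_edges _ he); rewrite map_f.
have inE' e z : e \in edges D -> same_loop (e, true) (z, true) -> z \in edges D.
  move=> /edX he [] /(reach_in he); first by rewrite mem_X.
  by rewrite mem_flip mem_X.
rewrite /loops map_flatten -map_comp; apply: uniq_perm.
- apply: uniq_flatten_map.
  + exact/filter_uniq/uniq_edges.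
  + move=> e; rewrite mem_filter => /andP [_ he]; have [u _ mem] := loop_atP he.
    change (uniq (map fst (loop_at D J e))).
    rewrite map_inj_in_uniq // => -[x b] [y b'] xl yl /= exy.
    case: (eqVneq b b') => [->|ne]; first by rewrite exy.
    case: (@reach_flipF (x, b)).
      by apply: reach_in (edX _ he) _; apply/mem.
    apply: (@reach_trans _ (e, true)).
      by apply: reach_sym; [exact: edX | exact/mem].
    have e2 : b' = ~~ b by move: ne; case: (b); case: (b').
    by apply/mem; move: yl; rewrite -exy e2.
  + move=> e e'; rewrite !mem_filter => /andP [le he] /andP [le' he'] z /=.
    move=> /(loop_at_edges _ he) h /(loop_at_edges _ he') h'.
    have hee' : same_loop (e, true) (e', true).
      exact: same_loop_trans (edX _ he) h (same_loop_sym (edX _ he') h').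
    apply/eqP; rewrite eqn_leq; apply/andP; split.
      exact: ((leE _ he).1 le _ hee').
    by apply: ((leE _ he').1 le'); apply: same_loop_sym hee'; apply: edX.
- exact: uniq_edges.
- move=> e; apply/flatten_mapP/idP.
    case=> e'; rewrite mem_filter => /andP [_ he'] /=.
    by move=> /(loop_at_edges _ he') /inE'; apply.
  move=> he; pose P z := z \in [seq x.1 | x <- loop_at D J e].
  have exP : exists z, P z by exists e; apply/loop_at_edges => //; left; exists 0%N.
  case: (ex_minnP exP) => m /(loop_at_edges _ he) hm min.
  have hmD := inE' _ _ he hm.
  exists m; last by apply/loop_at_edges => //; apply: same_loop_sym hm; apply: edX.
  rewrite mem_filter hmD andbT; apply/leE => // z hz; apply: min.
  by apply/loop_at_edges => //; apply: same_loop_trans hz => //; apply: edX.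
Qed.

Lemma loopsP l : l \in loops D J -> [/\ l != [::], fcycle adv l & {subset l <= X}].
Proof.
case/mapP => e; rewrite mem_filter => /andP [_ he] ->.
have [_ cl mem] := loop_atP he; split=> // y /mem.
by apply: reach_in; rewrite mem_X.
Qed.

Lemma coherent_passage x : x \in X -> coherent (x, (passage J x).1, (passage J x).2).
Proof.
rewrite (perm_mem perm_passage_sources) => /mapP [t ht ->]; rewrite passageP //.
case/flatten_mapP: ht => j /(allP coh) cj; rewrite !inE => /orP [] /eqP -> /=.
  by case: j cj => [[]].
by move: cj; case: j => [[[e []] [e' []]] [s|]].
Qed.

Lemma charge_loop l : fcycle adv l -> {subset l <= X} ->
  `|charge (map seg l)|%N = size (reduce (cusps J l)).
Proof.
rewrite size_reduce; case: l => [|x l] cl sub; first by rewrite /charge /= big_nil.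
have pl : fpath adv x l by move: cl; rewrite /= rcons_path => /andP [].
(* By coherence the sign of the current end changes exactly when a cusp is passed, as does the sign
   in the alternating sum [rotation]. *)
suff -> : charge (map seg (x :: l)) = sign x.2 * rotation (cusps J (x :: l)).
  by rewrite abszM (_ : `|sign x.2|%N = 1%N) ?mul1n //; case: x.2.
have {cl sub} xX : x \in X by apply: sub; rewrite mem_head.
elim: l x pl xX => [|y l IH] x /= pl xX; rewrite charge_cons.
  rewrite /charge big_nil /seg /join_segment /cusps /=.
  by case: (passage J x).2 => [s|] /=; rewrite ?mulr0 // addr0 subr0.
case/andP: pl => /eqP ey pl; rewrite [map _ _]/= in IH *.
have yX : y \in X by rewrite -ey; apply: adv_in.
rewrite (IH y) // /cusps /=; move: (coherent_passage xX).
have -> : y.2 = ~~ (passage J x).1.2 by rewrite -ey.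
rewrite /seg /join_segment /coherent; case: (passage J x) => [[z b] [s|]] /=.
  by case: x {xX ey} => e [] /=; case: b => //= _; ring.
by case: x {xX ey} => e [] /=; case: b => //= _; ring.
Qed.

Theorem tracing_loops :
  tracing (map join_segment J) [seq size (reduce (cusps J l)) | l <- loops D J].
Proof.
set L := loops D J.
exists (map (map seg) L).
- apply/allP => _ /mapP [l /loopsP [l0 cl sub] ->]; apply/andP; split.
    by case: (l) l0.
  rewrite cycle_map; apply: sub_cycle cl => x y /eqP <-.
  by rewrite /linked /source /target /= eqxx.
- have XL : {subset flatten L <= X}.
    by move=> x /flattenP [l /loopsP [_ _ sub]]; apply: sub.
  (* Each edge is travelled once, in one direction; the flips supply its other end. *)
  have p1 : perm_eq (flatten L ++ map flip (flatten L)) X.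
    rewrite perm_sym (permPl ends_D).
    have p := perm_loops_edges; rewrite -/L in p.
    rewrite perm_sym in p.
    apply: (perm_trans (perm_cat (perm_map (fun e => (e, true)) p)
                                 (perm_map (fun e => (e, false)) p))).
    elim: (flatten L) => //= -[e b] s IH.
    apply/permP => P; move/permP/(_ P): IH.
    rewrite !count_cat /= !count_cat /=; case: b => /=;
      [rewrite -[flip (e, true)]/(e, false) | rewrite -[flip (e, false)]/(e, true)]; lia.
  (* Advancing only rotates a loop, so the mates of its ends are their flips in another order: these
     are the sources of the reversed segments. *)
  have p2 : perm_eq (map mate (flatten L)) (map flip (flatten L)).
    have -> : map mate (flatten L) = map flip (map adv (flatten L)).
      by rewrite -map_comp; apply: eq_map => x /=; rewrite flipK.
    apply: perm_map; have : {subset L <= L} by [].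
    elim: {1 3 4}L => //= l s IH sub; rewrite map_cat perm_cat ?IH //; last first.
      by move=> l' hl'; apply: sub; rewrite inE hl' orbT.
    have /loopsP [_ /map_fcycle -> _] : l \in L by apply: sub; rewrite mem_head.
    by rewrite perm_rot.
  rewrite -map_flatten /twoway -map_comp.
  have -> : map (back \o seg) (flatten L) = map seg (map mate (flatten L)).
    by rewrite -map_comp; apply/eq_in_map => x /XL xX /=; have [_ _ _ ->] := mate_in xX.
  rewrite -map_cat -(permPr perm_segs); apply: perm_map.
  by apply: perm_trans p1; rewrite perm_cat2l.
- rewrite /charges -map_comp; suff /eq_in_map -> : {in L, (fun l => size (reduce (cusps J l)))
    =1 (fun l => `|charge l|%N) \o map seg} by [].
  by move=> l /loopsP [_ cl sub] /=; rewrite charge_loop.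
Qed.
End StateLoops.

(** * The bracket of a system of segments *)

Definition code_ends (C : Type) (D : seq (vertex C)) : seq edge_end :=
  flatten (map (@corners C) D).

(** The counterpart of [balanced] for codes. It depends only on the edge-ends, hence passes to
    permuted codes and to other decorations of the crossings. *)
Definition well_formed (C : Type) (D : seq (vertex C)) : bool :=
  uniq (code_ends D) && perm_eq (map flip (code_ends D)) (code_ends D).

Definition move_end (f : nat -> nat) (x : edge_end) : edge_end := (f x.1, x.2).

Definition move_segment (f : nat -> nat) (j : segment) : segment :=
  (move_end f (source j), move_end f (target j), j.2).

Definition move_join (f : nat -> nat) (j : join) : join :=
  (move_end f j.1.1, move_end f j.1.2, j.2).

Lemma twoway_move f J : twoway (map (move_segment f) J) = map (move_segment f) (twoway J).
Proof. by rewrite /twoway map_cat -!map_comp. Qed.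

Lemma ends_move f J : ends (map (move_segment f) J) = map (move_end f) (ends J).
Proof. by rewrite /ends twoway_move -!map_comp. Qed.

Lemma code_ends_relabel (C : Type) f (D : seq (vertex C)) :
  code_ends (map (relabel f) D) = map (move_end f) (code_ends D).
Proof.
rewrite /code_ends map_flatten -!map_comp; congr flatten; apply: eq_map.
by case=> [c [x y] [z t]|[x y] [z t]|[x y]].
Qed.

Lemma code_ends_cat (C : Type) (D1 D2 : seq (vertex C)) :
  code_ends (D1 ++ D2) = code_ends D1 ++ code_ends D2.
Proof. by rewrite /code_ends map_cat flatten_cat. Qed.

Lemma perm_code_ends (C : eqType) (D1 D2 : seq (vertex C)) :
  perm_eq D1 D2 -> perm_eq (code_ends D1) (code_ends D2).
Proof. by move=> p; apply/perm_flatten/perm_map. Qed.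

Lemma perm_well_formed (C C' : Type) (D1 : seq (vertex C)) (D2 : seq (vertex C')) :
  perm_eq (code_ends D1) (code_ends D2) -> well_formed D1 = well_formed D2.
Proof.
move=> e; rewrite /well_formed (perm_uniq e); congr (_ && _).
by rewrite (permPr e) (permPl (perm_map _ e)).
Qed.

Lemma perm_by_direction (s : seq edge_end) :
  perm_eq s ([seq (e, true) | e <- [seq x.1 | x <- s & x.2]] ++
             [seq (e, false) | e <- [seq x.1 | x <- s & ~~ x.2]]).
Proof.
elim: s => //= -[e []] s IH /=; first by rewrite perm_cons.
by rewrite perm_sym -cat1s perm_catCA /= perm_cons perm_sym.
Qed.

Lemma heads_edges (C : eqType) (D : seq (vertex C)) : heads (map (@corners C) D) = edges D.
Proof.
rewrite /heads /edges; elim: D => //= v D IH.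
by rewrite filter_cat !map_cat IH; case: v.
Qed.

Lemma plane_code_ends (C : eqType) (D : seq (vertex C)) : plane_graph (map (@corners C) D) ->
  perm_eq (code_ends D) ([seq (e, true) | e <- edges D] ++ [seq (e, false) | e <- edges D])
  /\ uniq (edges D).
Proof.
case/and3P => _ /andP [u p] _; rewrite -heads_edges; split=> //.
apply: (perm_trans (perm_by_direction _)); rewrite perm_cat2l; apply: perm_map.
by rewrite perm_sym.
Qed.

Lemma plane_well_formed (C : eqType) (D : seq (vertex C)) :
  plane_graph (map (@corners C) D) -> well_formed D.
Proof.
case/plane_code_ends => p u; rewrite /well_formed (perm_uniq p) (permPl (perm_map _ p)) (permPr p).
move: (edges D) u => E u {p}; rewrite map_cat -!map_comp perm_catC perm_refl andbT cat_uniq.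
have inj (b : bool) : injective (fun e : nat => (e, b)) by move=> ? ? [].
rewrite (map_inj_uniq (inj true)) (map_inj_uniq (inj false)) u andbT.
by apply/hasPn => _ /mapP [e _ ->]; apply/negP => /mapP [].
Qed.

Section Bracket.
Variables (T : comNzRingType) (a a' : T) (k : nat -> T).
Local Notation d := (- a ^+ 2 - a' ^+ 2).

Definition loop_value (n : nat) : T := if n./2 == 0%N then 1 else k n./2.

Definition value (mu : seq nat) : T := d ^+ (size mu).-1 * \prod_(n <- mu) loop_value n.

(** [trace] picks one tracing, and uniqueness makes any other equally good. The default 0 makes
    [bracket_perm] unconditional. *)
Definition bracket (J : seq segment) : T :=
  if balanced J then value (trace (size J) J) else 0.

Lemma bracket_tracing J mu : balanced J -> tracing J mu -> bracket J = value mu.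
Proof.
move=> bJ tr; have p := tracing_unique (erefl _) bJ tr.
by rewrite /bracket bJ /value (perm_size p) (perm_big _ p).
Qed.

Lemma bracket_perm J1 J2 : perm_eq (twoway J1) (twoway J2) -> bracket J1 = bracket J2.
Proof.
move=> p; case: (boolP (balanced J1)) => b1; last first.
  by rewrite /bracket -(perm_balanced (perm_ends p)) (negPf b1).
have b2 := b1; rewrite (perm_balanced (perm_ends p)) in b2.
have tr := trace_exists (erefl _) b1.
by rewrite (bracket_tracing b1 tr) (bracket_tracing b2 (tracing_perm p tr)).
Qed.

Lemma bracket_fuse j1 j2 J : linked j1 j2 -> balanced (j1 :: j2 :: J) ->
  bracket (j1 :: j2 :: J) = bracket (fuse j1 j2 :: J).
Proof.
move=> l12 b; have b' := balanced_fuse l12 b; have tr := trace_exists (erefl _) b'.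
by rewrite (bracket_tracing b' tr) (bracket_tracing b (tracing_fuse l12 tr)).
Qed.

Lemma bracket_loop j J : target j = flip (source j) -> j.2 = 0 -> J != [::] ->
  balanced (j :: J) -> bracket (j :: J) = d * bracket J.
Proof.
move=> lj j0 J0 b; have b' := balanced_loop lj b; have tr := trace_exists (erefl _) b'.
rewrite (bracket_tracing b' tr) (bracket_tracing b (tracing_loop lj tr)).
rewrite /value big_cons j0 mul1r mulrA /=.
(* The exponent of [d] is the truncated number of loops minus one, so the new loop yields a factor
   [d] only if another loop is present. *)
suff : trace (size J) J != [::] by case: (trace _ _) => // n mu _; rewrite /= (exprS d).
apply: contra_neq J0 => tr0; case: tr => L _ pL; rewrite tr0 => /perm_size /esym.
rewrite size_map /= => /size0nil eL; have := perm_size pL.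
by rewrite eL /twoway /= size_cat size_map addnn => /esym/eqP; rewrite double_eq0 => /nilP.
Qed.

(** Pushing a tracing forward keeps links and charges, and balance of the image makes the result its
    only tracing. *)
Lemma bracket_move f J : balanced J -> balanced (map (move_segment f) J) ->
  bracket (map (move_segment f) J) = bracket J.
Proof.
move=> b b'; have [L cL eL emu] := trace_exists (erefl _) b.
have tr : tracing (map (move_segment f) J) (trace (size J) J).
  exists (map (map (move_segment f)) L).
  - rewrite all_map; apply: sub_all cL => l /andP [l0 cl]; apply/andP; split.
      by case: (l) l0.
    rewrite cycle_map; apply: sub_cycle cl => i j /eqP h.
    by apply/eqP; rewrite /source /target /= -/(source j) h.
  - by rewrite -map_flatten !twoway_move perm_map.
  - apply: (perm_trans emu); rewrite /charges -map_comp.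
    suff /eq_map -> : (fun l => `|charge l|%N) =1
      (fun l => `|charge l|%N) \o map (move_segment f) by [].
    by move=> l /=; rewrite /charge big_map.
by rewrite (bracket_tracing b' tr) /bracket b.
Qed.

(** * Sums over states *)

(** With an arbitrary function of the joins, the sum splits along a concatenation of codes: a local
    picture can be summed while the joins of the rest are frozen. *)
Definition sum_states (D : seq (vertex bool)) (F : seq join -> T) : T :=
  \sum_(S <- states a a' D) weight S * F (flatten (map snd S)).

Lemma sum_states_cons v D F : sum_states (v :: D) F =
  \sum_(r <- smoothings a a' v) r.1 * sum_states D (fun J => F (r.2 ++ J)).
Proof.
rewrite /sum_states /= big_allpairs_dep /=; apply: eq_bigr => r _.
by rewrite big_distrr; apply: eq_bigr => S _; rewrite /weight big_cons /= mulrA.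
Qed.

Lemma sum_states_nil F : sum_states [::] F = F [::].
Proof. by rewrite /sum_states big_seq1 /weight big_nil mul1r. Qed.

Lemma sum_states_sum D (I : Type) (s : seq I) (c : I -> T) (F : I -> seq join -> T) :
  sum_states D (fun J => \sum_(i <- s) c i * F i J) = \sum_(i <- s) c i * sum_states D (F i).
Proof.
under [RHS]eq_bigr => i _ do rewrite big_distrr.
rewrite exchange_big /=; apply: eq_bigr => S _; rewrite big_distrr.
by apply: eq_bigr => i _; rewrite mulrCA.
Qed.

Lemma sum_statesZ D c F : sum_states D (fun J => c * F J) = c * sum_states D F.
Proof.
have := sum_states_sum D [:: tt] (fun=> c) (fun=> F).
by rewrite big_seq1 => <-; apply: eq_bigr => S _; rewrite big_seq1.
Qed.

Lemma sum_states_cat D1 D2 F : sum_states (D1 ++ D2) F =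
  sum_states D1 (fun J1 => sum_states D2 (fun J2 => F (J1 ++ J2))).
Proof.
elim: D1 F => [|v D1 IH] F /=; first by rewrite sum_states_nil.
rewrite !sum_states_cons; apply: eq_bigr => r _; rewrite IH; congr (_ * _).
by apply: eq_bigr => S1 _; congr (_ * _); apply: eq_bigr => S2 _; rewrite catA.
Qed.

Definition admissible (D : seq (vertex bool)) (J : seq join) : Prop :=
  all coherent J /\ perm_eq (ends (map join_segment J)) (code_ends D).

Lemma smoothings_admissible v r : r \in smoothings a a' v -> admissible [:: v] r.2.
Proof.
rewrite /admissible /code_ends /ends /twoway; case: v => [b [x y] [z t]|[x y] [z t]|[x y]];
  rewrite /= !inE; try (case/orP); move/eqP=> -> /=; split=> //;
  apply/permP => P; cbn -[addn]; lia.
Qed.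

Lemma eq_sum_states D F G : (forall J, admissible D J -> F J = G J) ->
  sum_states D F = sum_states D G.
Proof.
elim: D F G => [|v D IH] F G h; first by rewrite !sum_states_nil h.
rewrite !sum_states_cons; apply: eq_big_seq => r /smoothings_admissible [c1 p1].
congr (_ * _); apply: IH => J [c2 p2]; apply: h; split; first by rewrite all_cat c1.
rewrite map_cat (permPl (ends_cat _ _)) -cat1s code_ends_cat.
exact: perm_cat.
Qed.

Lemma sum_states_perm D1 D2 F : {homo F : J1 J2 / perm_eq J1 J2 >-> J1 = J2} ->
  perm_eq D1 D2 -> sum_states D1 F = sum_states D2 F.
Proof.
elim: D1 D2 F => [|v D1 IH] D2 F hF p.
  by move: p; rewrite perm_sym => /perm_nilP ->.
have vD : v \in D2 by rewrite -(perm_mem p) mem_head.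
case/splitPr: vD p => D3 D4; rewrite perm_sym -(cat1s v D4) perm_catCA perm_cons perm_sym => p.
rewrite sum_states_cons sum_states_cat.
under [RHS]eq_bigr => S _ do rewrite sum_states_cons.
rewrite -/(sum_states D3 (fun J1 => \sum_(r <- smoothings a a' v)
             r.1 * sum_states D4 (fun J => F (J1 ++ (r.2 ++ J))))).
rewrite sum_states_sum; apply: eq_bigr => r _; congr (_ * _).
rewrite (IH (D3 ++ D4)) // ?sum_states_cat; last first.
  by move=> J1 J2 pJ; apply: hF; rewrite perm_cat2l.
apply: eq_bigr => S1 _; congr (_ * _); apply: eq_bigr => S2 _; congr (_ * _).
by apply: hF; rewrite perm_catCA.
Qed.

Lemma sum_states_relabel f D F :
  sum_states (map (relabel f) D) F = sum_states D (fun J => F (map (move_join f) J)).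
Proof.
elim: D F => [|v D IH] F; first by rewrite !sum_states_nil.
rewrite /= !sum_states_cons.
have -> : smoothings a a' (relabel f v) =
  [seq (r.1, map (move_join f) r.2) | r <- smoothings a a' v].
  by case: v => [b [x y] [z t]|[x y] [z t]|[x y]].
rewrite big_map; apply: eq_bigr => r _; rewrite IH /=; congr (_ * _).
by apply: eq_bigr => S _; rewrite map_cat.
Qed.

Definition code_bracket (D : seq (vertex bool)) : T :=
  sum_states D (fun J => bracket (map join_segment J)).

Lemma state_sum_bracket D : plane_graph (map (@corners bool) D) ->
  state_sum a a' k D = code_bracket D.
Proof.
move=> pl; have [pD _] := plane_code_ends pl; have wf := plane_well_formed pl.
transitivity (sum_states D (fun J => value [seq size (reduce (cusps J l)) | l <- loops D J])).
  apply: eq_bigr => S _; rewrite -mulrA; congr (_ * _).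
  by rewrite /value size_map big_map.
apply: eq_sum_states => J [cJ pJ]; apply/esym/bracket_tracing.
  by move: wf; rewrite /well_formed /balanced (perm_uniq pJ) (permPl (perm_map _ pJ)) (permPr pJ).
apply: tracing_loops => //.
  by move: wf; rewrite /well_formed /balanced (perm_uniq pJ) (permPl (perm_map _ pJ)) (permPr pJ).
exact: perm_trans pJ pD.
Qed.

Lemma code_bracket_perm D1 D2 : perm_eq D1 D2 -> code_bracket D1 = code_bracket D2.
Proof.
by move=> p; apply: sum_states_perm => // J1 J2 pJ; apply/bracket_perm/perm_twoway/perm_map.
Qed.

End Bracket.

(** * Local moves *)

Lemma unit_powerD (T : comNzRingType) (u u' : T) (m n : int) :
  u * u' = 1 -> unit_power u u' (m + n) = unit_power u u' m * unit_power u u' n.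
Proof.
move=> uu'.
have S x : unit_power u u' (x + 1) = u * unit_power u u' x.
  case: x => [x|[|x]]; first by rewrite -PoszD addn1 /= exprS.
    by rewrite /= expr1.
  have -> : Negz x.+1 + 1 = Negz x by rewrite !NegzE; lia.
  by rewrite /= [in RHS]exprS mulrA uu' mul1r.
have P x : unit_power u u' (x - 1) = u' * unit_power u u' x.
  by rewrite -{2}(subrK 1 x) S mulrA (mulrC u') uu' mul1r.
elim/int_ind: m => [|m IH|m IH]; first by rewrite add0r mul1r.
  by rewrite -addn1 PoszD addrAC !S IH mulrA.
by rewrite -addn1 PoszD opprD addrAC !P IH mulrA.
Qed.

(* [(c, e, J)] stands for [c * A ^ e] times the bracket of [J], completed by
   segments outside of the local picture. *)
Definition term := (int * int * seq segment)%type.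

Definition local_smoothings (v : vertex bool) : seq (int * seq segment) :=
  match v with
  | Cross b p q =>
      [:: (sign b, map join_segment [:: straight (p.1, q.2); straight (q.1, p.2)]);
          (- sign b, map join_segment [:: ((p.1, true), (q.1, true), Some true);
                                          ((p.2, false), (q.2, false), Some true)])]
  | Virt p q => [:: (0, map join_segment [:: straight p; straight q])]
  | Mark p => [:: (0, map join_segment [:: straight p])]
  end.

Definition local_terms (D : seq (vertex bool)) : seq term :=
  foldr (fun v ts => flatten [seq [seq (t.1.1, r.1 + t.1.2, r.2 ++ t.2) | t <- ts]
                             | r <- local_smoothings v]) [:: (1, 0, [::])] D.

(* Fusing the two segments which meet on the edge [i]; the outcome is checked,
   and the term is left as it is if this fails. *)
Definition contract (i : nat) (t : term) : seq term :=
  let J := t.2 in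
  if [seq j <- twoway J | target j == (i, true)] is j1 :: _ then
    if source j1 == (i, false) then
      let R := discard J j1 in
      if [&& j1.2 == 0, R != [::] & perm_eq (twoway (j1 :: R)) (twoway J)] then
        [:: (- t.1.1, t.1.2 + 2, R); (- t.1.1, t.1.2 - 2, R)]
      else [:: t]
    else if [seq j <- twoway J | source j == (i, false)] is j2 :: _ then
      let R := discard (discard J j1) j2 in
      if linked j1 j2 && perm_eq (twoway (j1 :: j2 :: R)) (twoway J) then
        [:: (t.1.1, t.1.2, fuse j1 j2 :: R)]
      else [:: t]
    else [:: t]
  else [:: t].

Definition contract_all (es : seq nat) (ts : seq term) : seq term :=
  foldl (fun ts i => flatten (map (contract i) ts)) ts es.

(** Segments are directed towards the larger end and sorted, so that equal systems become
    syntactically equal. The final test makes soundness independent of the sorting. *)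
Definition normal_form (J : seq segment) : seq segment :=
  let code (x : edge_end) := (x.1.*2 + x.2)%N in
  let J' := sort (fun j j' => code (source j) <= code (source j'))%N
                 [seq j <- twoway J | (code (source j) <= code (target j))%N] in
  if perm_eq (twoway J') (twoway J) then J' else J.

Definition normalize (t : term) : term := (t.1.1, t.1.2, normal_form t.2).

Definition coefficient (ts : seq term) (t : term) : int :=
  foldr (fun t' s => if (t'.1.2, t'.2) == (t.1.2, t.2) then t'.1.1 + s else s) 0 ts.

Definition vanishing (ts : seq term) : bool := all (fun t => coefficient ts t == 0) ts.

(* [L] equals [c * A ^ e] times [L']; the edges in [es] are internal. *)
Definition local_equation (es : seq nat) (L L' : seq (vertex bool)) (c e : int) : bool :=
  vanishing (map normalize (contract_all es (local_terms L)) ++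
    [seq (- c * t.1.1, e + t.1.2, t.2)
       | t <- map normalize (contract_all es (local_terms L'))]).

(** The edges 0 to 8 stand for a0, ..., c2, so the inner edges a1, b1, c1 are 1, 4, 7. *)
Lemma triangle_equation eab eac ebc : local_equation [:: 1; 4; 7]%N
  (triangle id true eab eac ebc 0 1 2 3 4 5 6 7 8)
  (triangle id false eab eac ebc 0 1 2 3 4 5 6 7 8) 1 0.
Proof. by move: eab eac ebc => [] [] []; vm_compute. Qed.

(** Three of the four states join the outer ends alike, with coefficients [d], [A^2] and [A^-2], and
    cancel; the fourth leaves the two strands. *)
Lemma bigon_equation e (par : bool) : local_equation [:: 1; 4]%N
  [:: over_under id e (0, 1) (if par then (3, 4) else (4, 5));
      over_under id (~~ e) (1, 2) (if par then (4, 5) else (3, 4))]%N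
  [:: Mark (0, 2); Mark (3, 5)]%N 1 0.
Proof. by move: e par => [] []; vm_compute. Qed.

(** The oriented smoothing splits off a loop without cusps and the disoriented one has two
    cancelling cusps: at a positive crossing [A d + A^-1 = -A^3]. *)
Lemma kink_equation (o e : bool) : local_equation [:: 1]%N
  [:: if o then over_under id e (0, 1) (1, 2) else over_under id e (1, 2) (0, 1)]%N
  [:: Mark (0, 2)]%N (-1) (if e then 3 else -3).
Proof. by move: o e => [] []; vm_compute. Qed.

(** * Soundness of the local computations *)

Section LocalSoundness.
Variables (T : comNzRingType) (a a' : T) (k : nat -> T).
Hypothesis aa' : a * a' = 1.
Local Notation d := (- a ^+ 2 - a' ^+ 2).
Local Notation A_pow := (unit_power a a').

Definition eval (F : seq segment -> T) (t : term) : T := t.1.1%:~R * A_pow t.1.2 * F t.2.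
Definition eval_sum (F : seq segment -> T) (ts : seq term) : T := \sum_(t <- ts) eval F t.

Lemma local_smoothingsE v (G : seq segment -> T) :
  \sum_(r <- smoothings a a' v) r.1 * G (map join_segment r.2) =
  \sum_(r <- local_smoothings v) A_pow r.1 * G r.2.
Proof.
by case: v => [[] p q|p q|p]; rewrite /= !big_cons !big_nil /= ?expr1.
Qed.

Lemma local_termsE D (F : seq segment -> T) :
  sum_states a a' D (fun J => F (map join_segment J)) = eval_sum F (local_terms D).
Proof.
elim: D F => [|v D IH] F.
  by rewrite sum_states_nil /eval_sum big_seq1 /eval /= !mul1r.
rewrite sum_states_cons.
transitivity (\sum_(r <- smoothings a a' v)
    r.1 * eval_sum (fun J => F (map join_segment r.2 ++ J)) (local_terms D)).
  apply: eq_bigr => r _; rewrite -IH; congr (_ * _).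
  by apply: eq_bigr => S _; rewrite map_cat.
rewrite (local_smoothingsE v (fun J1 => eval_sum (fun J => F (J1 ++ J)) (local_terms D))).
rewrite /eval_sum /= big_flatten /= big_map; apply: eq_bigr => r _.
rewrite big_map big_distrr; apply: eq_bigr => t _.
by rewrite /eval /= (unit_powerD _ _ aa') !mulrA [A_pow _ * _]mulrC.
Qed.

Lemma local_terms_ends D t : t \in local_terms D -> perm_eq (ends t.2) (code_ends D).
Proof.
elim: D t => [|v D IH] t; first by rewrite inE => /eqP ->.
move=> /= /flatten_mapP [r hr /mapP [t' /IH p ->]] /=.
rewrite (permPl (ends_cat _ _)) -cat1s code_ends_cat; apply: perm_cat p.
rewrite /ends /twoway; case: v hr => [b [x y] [z w]|[x y] [z w]|[x y]];
  rewrite /= !inE; try (case/orP); move/eqP=> -> /=;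
  apply/permP => P; cbn -[addn]; lia.
Qed.

Section Context.
Variables (f : nat -> nat) (E : seq segment).

Let F (J : seq segment) : T := bracket a a' k (map (move_segment f) J ++ E).
Let fits (t : term) : bool := balanced (map (move_segment f) t.2 ++ E).

Lemma perm_context J1 J2 : perm_eq (twoway J1) (twoway J2) ->
  perm_eq (twoway (map (move_segment f) J1 ++ E)) (twoway (map (move_segment f) J2 ++ E)).
Proof.
move=> p; rewrite (permPl (twoway_cat _ _)) perm_sym (permPl (twoway_cat _ _)) perm_sym.
by rewrite perm_cat2r !twoway_move perm_map.
Qed.

Lemma contractE i t : fits t -> all fits (contract i t) /\ eval F t = eval_sum F (contract i t).
Proof.
rewrite /fits /eval_sum; case: t => [[c e] J] ft.
have unchanged : all fits [:: (c, e, J)] /\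
    eval F (c, e, J) = \sum_(t <- [:: (c, e, J)]) eval F t by rewrite big_seq1 /= /fits ft.
rewrite /contract; set s1 := [seq j <- _ | _].
case E1: s1 => [|j1 s1'] //.
have t1 : target j1 = (i, true).
  have : j1 \in s1 by rewrite E1 mem_head.
  by rewrite mem_filter => /andP [/eqP].
case: eqP => [h1|_].
  (* A closed segment of charge 0 is a factor [d = -A^2 - A^-2], whence the two terms with exponents
     shifted by 2. *)
  case: ifP => // /and3P [/eqP q0 R0 p].
  have p' := perm_context p.
  have b : balanced (map (move_segment f) (j1 :: discard J j1) ++ E).
    by rewrite (perm_balanced (perm_ends p')).
  have l1 : target (move_segment f j1) = flip (source (move_segment f j1)).
    by rewrite /move_segment /target /source /= -/(target j1) t1 -/(source j1) h1.
  split; first by rewrite /= andbT /fits andbb (balanced_loop l1 b).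
  rewrite !big_cons big_nil addr0 /eval /= !(unit_powerD _ _ aa') /F -(bracket_perm _ _ _ p').
  rewrite [map _ (_ :: _)]/= cat_cons bracket_loop //; last by case: (discard J j1) R0.
  by rewrite mulrNz /=; ring.
case E2: [seq j <- _ | _] => [|j2 s2'] //; case: ifP => // /andP [l12 p].
have p' := perm_context p; set R := discard _ j2 in p p' *.
have b : balanced (map (move_segment f) (j1 :: j2 :: R) ++ E).
  by rewrite (perm_balanced (perm_ends p')).
have l12' : linked (move_segment f j1) (move_segment f j2).
  by move/eqP: l12 => h; apply/eqP; rewrite /source /target /= h.
split; first by rewrite /= andbT /fits; exact: balanced_fuse l12' b.
by rewrite big_seq1 /eval /= /F -(bracket_perm _ _ _ p') [map _ (_ :: _)]/= !cat_cons bracket_fuse.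
Qed.

Lemma contract_allE es ts : all fits ts -> eval_sum F ts = eval_sum F (contract_all es ts).
Proof.
elim: es ts => //= i es IH ts fts; rewrite -IH.
  rewrite /eval_sum big_flatten big_map /=; apply: eq_big_seq => t /(allP fts).
  by case/(contractE i).
apply/allP => t /flatten_mapP [t' /(allP fts) /(contractE i) [h _]].
exact: (allP h).
Qed.

Lemma normal_form_perm J : perm_eq (twoway (normal_form J)) (twoway J).
Proof. by rewrite /normal_form; case: ifP. Qed.

Lemma normalizeE ts : eval_sum F (map normalize ts) = eval_sum F ts.
Proof.
rewrite /eval_sum big_map; apply: eq_bigr => t _; rewrite /eval /F; congr (_ * _).
exact/bracket_perm/perm_context/normal_form_perm.
Qed.

Lemma vanishingE ts : vanishing ts -> eval_sum F ts = 0.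
Proof.
move=> v; pose key (t : term) := (t.1.2, t.2); pose G x := A_pow x.1 * F x.2.
(* The terms are grouped by exponent and system; each group carries a coefficient tested by
   [vanishing]. *)
transitivity (\sum_(x <- undup (map key ts)) \sum_(t <- ts | key t == x) t.1.1%:~R * G x).
  transitivity (\sum_(t <- ts) \sum_(x <- undup (map key ts) | key t == x) t.1.1%:~R * G x).
    apply: eq_big_seq => t tts; under eq_bigl => x do rewrite eq_sym.
    rewrite -big_filter (filter_pred1_uniq (undup_uniq _)) ?mem_undup ?map_f // big_seq1.
    by rewrite /eval mulrA.
  by rewrite (exchange_big_dep xpredT).
rewrite big_seq big1 // => x; rewrite mem_undup => /mapP [t tts ->].
rewrite -big_distrl /= -rmorph_sum /=.
suff -> : \sum_(t' <- ts | key t' == key t) t'.1.1 = coefficient ts t.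
  by move/allP: v => /(_ t tts) /eqP ->; rewrite mul0r.
rewrite /coefficient; elim: (ts) => [|t' s IH]; first by rewrite big_nil.
by rewrite big_cons /= IH.
Qed.

End Context.

(** [f] places the template in a diagram and may identify outer edges. Links survive [f], and
    well-formedness of both codes gives the balance that each contraction requires. *)
Lemma local_equationP es L L' c e (f : nat -> nat) D :
  local_equation es L L' c e ->
  well_formed (map (relabel f) L ++ D) -> well_formed (map (relabel f) L' ++ D) ->
  code_bracket a a' k (map (relabel f) L ++ D) =
  c%:~R * A_pow e * code_bracket a a' k (map (relabel f) L' ++ D).
Proof.
move=> eqn wf wf'.
have expand M : code_bracket a a' k (map (relabel f) M ++ D) = sum_states a a' D (fun J2 =>
    eval_sum (fun J1 => bracket a a' k (map (move_segment f) J1 ++ map join_segment J2))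
      (local_terms M)).
  rewrite (code_bracket_perm _ _ _ (permEl (perm_catC _ _))) /code_bracket sum_states_cat.
  apply: eq_bigr => S _; congr (_ * _); rewrite sum_states_relabel -local_termsE.
  apply: eq_bigr => S' _; congr (_ * _); apply/bracket_perm/perm_twoway.
  by rewrite map_cat -!map_comp perm_catC.
rewrite !expand -sum_statesZ; apply: eq_sum_states => J [_ pJ].
have fits M : well_formed (map (relabel f) M ++ D) -> all (fun t : term =>
    balanced (map (move_segment f) t.2 ++ map join_segment J)) (local_terms M).
  move=> wfM; apply/allP => t /local_terms_ends pt.
  have p : perm_eq (ends (map (move_segment f) t.2 ++ map join_segment J))
      (code_ends (map (relabel f) M ++ D)).
    rewrite (permPl (ends_cat _ _)) code_ends_cat ends_move code_ends_relabel.
    exact/perm_cat/pJ/perm_map.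
  by move: wfM; rewrite /well_formed /balanced (perm_uniq p) (permPl (perm_map _ p)) (permPr p).
rewrite (contract_allE es (fits _ wf)) (contract_allE es (fits _ wf')).
rewrite -[LHS]normalizeE -[in RHS]normalizeE.
move: eqn; rewrite /local_equation.
move: (map normalize _) (map normalize _) => ts' ts /(vanishingE f (map join_segment J)).
rewrite {1}/eval_sum big_cat big_map => /eqP; rewrite addr_eq0 => /eqP; rewrite -/(eval_sum _ ts) => ->.
rewrite /eval_sum big_distrr -sumrN; apply: eq_bigr => t _.
rewrite /eval /= (unit_powerD _ _ aa') intrM mulrNz.
by rewrite !mulNr opprK !mulrA [_ * A_pow e]mulrAC.
Qed.

End LocalSoundness.

(** * Invariance *)

Definition vertex_writhe (v : vertex bool) : int := if v is Cross b _ _ then sign b else 0.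
Definition code_writhe (D : seq (vertex bool)) : int := \sum_(v <- D) vertex_writhe v.

Lemma code_writhe_cat D1 D2 : code_writhe (D1 ++ D2) = code_writhe D1 + code_writhe D2.
Proof. exact: big_cat. Qed.

Lemma code_writhe_perm D1 D2 : perm_eq D1 D2 -> code_writhe D1 = code_writhe D2.
Proof. exact: perm_big. Qed.

Lemma code_writhe_relabel f D : code_writhe (map (relabel f) D) = code_writhe D.
Proof. by rewrite /code_writhe big_map; apply: eq_bigr => -[]. Qed.

Lemma regular_move_writhe D D' : regular_move id D D' -> code_writhe D = code_writhe D'.
Proof.
case=> [[f _ p]|[a b E _ p ->]|[a es es' O R R' _ v v' [E [p p']]]
  |[e par a0 a1 a2 b0 b1 b2 [E [p p']]]
  |[eab eac ebc a0 a1 a2 b0 b1 b2 c0 c1 c2 [E [p p']]]].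
- by rewrite (code_writhe_perm p) code_writhe_relabel.
- rewrite (code_writhe_perm p) code_writhe_relabel /code_writhe big_cons.
  exact: add0r.
- rewrite (code_writhe_perm p) (code_writhe_perm p') !code_writhe_cat; congr (_ + _).
  have flat_writhe al M : virtual_arc al O M -> code_writhe M = 0.
    case/and3P => _ _ /allP h; rewrite /code_writhe big_seq big1 // => w /h.
    by case: w.
  by rewrite (flat_writhe _ _ v) (flat_writhe _ _ v').
- rewrite (code_writhe_perm p) (code_writhe_perm p') !code_writhe_cat; congr (_ + _).
  by rewrite /code_writhe !big_cons !big_nil; case: e par {p} => [] [].
- rewrite (code_writhe_perm p) (code_writhe_perm p') !code_writhe_cat; congr (_ + _).
  by rewrite /code_writhe !big_cons !big_nil; case: eab eac ebc {p p'} => [] [] [].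
Qed.

Lemma code_ends_cons (C : Type) (v : vertex C) D : code_ends (v :: D) = corners v ++ code_ends D.
Proof. by []. Qed.

Section Invariance.
Variables (T : comNzRingType) (a a' : T) (k : nat -> T).
Hypothesis aa' : a * a' = 1.
Local Notation A_pow := (unit_power a a').
Local Notation br := (bracket a a' k).
Local Notation cbr := (code_bracket a a' k).

Lemma admissible_balanced D J : admissible D J ->
  balanced (map join_segment J) = well_formed D.
Proof.
by case=> _ p; rewrite /well_formed /balanced (perm_uniq p) (permPl (perm_map _ p)) (permPr p).
Qed.

Lemma map_join_segment_move f J :
  map join_segment (map (move_join f) J) = map (move_segment f) (map join_segment J).
Proof. by rewrite -!map_comp. Qed.

Lemma renaming_bracket D D' : renaming D D' -> well_formed D -> well_formed D' ->
  cbr D = cbr D'.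
Proof.
case=> f _ p wf wf'; rewrite (code_bracket_perm _ _ _ p) /code_bracket sum_states_relabel.
apply: eq_sum_states => J adm; rewrite map_join_segment_move bracket_move //.
  by rewrite (admissible_balanced adm).
have [_ pJ] := adm.
have pm : perm_eq (ends (map (move_segment f) (map join_segment J))) (code_ends D').
  rewrite perm_sym (permPl (perm_code_ends p)) code_ends_relabel ends_move perm_sym.
  exact: perm_map.
by move: wf'; rewrite /well_formed /balanced (perm_uniq pm) (permPl (perm_map _ pm)) (permPr pm).
Qed.

Lemma code_bracket_mark p D :
  cbr (Mark p :: D) =
  sum_states a a' D (fun J => br (join_segment (straight p) :: map join_segment J)).
Proof. by rewrite /code_bracket sum_states_cons /= big_seq1 mul1r. Qed.

Lemma source_in j J : j \in twoway J -> source j \in ends J.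
Proof. exact: map_f. Qed.

Lemma target_in j J : j \in twoway J -> target j \in ends J.
Proof. by rewrite -mem_twoway_back => /source_in. Qed.

(** Fusing the segment of the mark with its successor replaces the starting edge [b] of the latter
    by [a], which is what the relabelling does. *)
Lemma unmarking_bracket D D' : unmarking D D' -> well_formed D -> cbr D = cbr D'.
Proof.
case=> x y E xy p ->; rewrite (perm_well_formed (perm_code_ends p)) => wf.
rewrite (code_bracket_perm _ _ _ p) code_bracket_mark /code_bracket sum_states_relabel.
apply: eq_sum_states => J adm; rewrite map_join_segment_move.
set K := map join_segment J; set s := join_segment _.
have bK : balanced (s :: K).
  rewrite -(@admissible_balanced (Mark (x, y) :: E) (straight (x, y) :: J)) // in wf.
  case: adm => c pJ; split; first by rewrite /= c.
  by rewrite [map _ _]/= (permPl (ends_cons _ _)) /code_ends /= !perm_cons.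
have ts : target s != flip (source s) by rewrite xpair_eqE /= eq_sym (negPf xy).
have [iK si] := successorP bK ts; set i := successor K s in iK si.
have [uK _ _ _ _] := balanced_ends_cons bK; have pK := perm_discard uK iK.
set R := discard K i in pK; have pS : perm_eq (twoway (s :: K)) (twoway (s :: i :: R)).
  by rewrite twoway_cons2.
have bS : balanced (s :: i :: R) by rewrite -(perm_balanced (perm_ends pS)).
rewrite (bracket_perm _ _ _ pS) (bracket_fuse _ _ _ si bS).
rewrite [RHS](bracket_perm _ _ _ (J2 := map (move_segment (fun z => if z == y then x else z)) (i :: R)));
  last by rewrite !twoway_move; apply: perm_map.
(* Both ends of [y] are used where [s] meets [i], so the relabelling fixes everything else. *)
have ne z : z \in target i :: ends R -> z.1 != y.
  move=> hz; case/andP: bS => + _; rewrite uniq_ends_cons => /and3P [_ h1].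
  rewrite uniq_ends_cons => /and3P [h2 _ _].
  rewrite (perm_mem (ends_cons i R)) inE negb_or in h1; case/andP: h1 => _ h1.
  move/eqP: si => si; rewrite si in h2.
  case: z hz => z [] hz; apply/eqP => /= ez.
    by rewrite -[flip _]/(y, true) -ez hz in h2.
  by rewrite -[target s]/(y, false) -ez hz in h1.
pose g := fun z => if z == y then x else z.
have gE z : z \in target i :: ends R -> move_end g z = z.
  by move=> /ne; rewrite /move_end /g; case: z => z b /= /negPf ->.
rewrite /= (_ : map _ R = R); last first.
  rewrite -[RHS]map_id; apply/eq_in_map => -[[u v] q] jR.
  have jR' : (u, v, q) \in twoway R by rewrite mem_cat jR.
  rewrite /move_segment /source /target /= !gE // inE.
    by rewrite (target_in jR') orbT.
  by rewrite (source_in jR') orbT.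
congr (br (_ :: _)); rewrite /fuse /move_segment (gE (target i)) ?mem_head //.
by rewrite (eqP si) /s /= add0r /move_end /g /= eqxx.
Qed.

Definition strand_segment (p : strand) : segment := join_segment (straight p).

Lemma arc_bracket x es J : es != [::] -> balanced (map strand_segment (Defs.arc x es) ++ J) ->
  balanced (strand_segment (x, last x es) :: J) /\
  br (map strand_segment (Defs.arc x es) ++ J) = br (strand_segment (x, last x es) :: J).
Proof.
case: es => // y es _; elim: es x y J => [|z es IH] x y J //= b.
have p : perm_eq (strand_segment (x, y) :: map strand_segment (Defs.arc y (z :: es)) ++ J)
                 (map strand_segment (Defs.arc y (z :: es)) ++ strand_segment (x, y) :: J).
  by rewrite -cat1s perm_catCA.
have b1 : balanced (map strand_segment (Defs.arc y (z :: es)) ++ strand_segment (x, y) :: J).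
  by rewrite -(perm_balanced (perm_ends (perm_twoway p))).
have [b2 e2] := IH _ _ _ b1.
have p2 : perm_eq (strand_segment (y, last z es) :: strand_segment (x, y) :: J)
                  (strand_segment (x, y) :: strand_segment (y, last z es) :: J).
  by apply/permP => P /=; rewrite addnCA.
rewrite /= (perm_balanced (perm_ends (perm_twoway p2))) in b2.
have l : linked (strand_segment (x, y)) (strand_segment (y, last z es)) by exact: eqxx.
split; first exact: balanced_fuse l b2.
rewrite (bracket_perm _ _ _ (perm_twoway p)) e2 (bracket_perm _ _ _ (perm_twoway p2)).
by rewrite bracket_fuse.
Qed.

Lemma sum_states_virtual R F : ~~ has (@is_real bool) R ->
  sum_states a a' R F = F (map straight (flatten (map (@strands_at bool) R))).
Proof.
elim: R F => [|v R IH] F; first by rewrite sum_states_nil.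
rewrite /= negb_or sum_states_cons => /andP [nv nR].
by case: v nv => // [p q|p] _; rewrite /= big_seq1 mul1r IH.
Qed.

(** The right-hand side sees only the two extremities of the arc and the strands [O], which both
    sides of a detour share. *)
Lemma virtual_arc_bracket x es O R E : virtual_arc (Defs.arc x es) O R ->
  well_formed (R ++ E) ->
  cbr (R ++ E) = sum_states a a' E (fun J =>
    br (strand_segment (x, last x es) :: map strand_segment O ++ map join_segment J)).
Proof.
case/and3P => al0 p nc wf; rewrite /code_bracket sum_states_cat sum_states_virtual; last first.
  by apply/hasPn => v /(allP nc); case: v.
apply: eq_sum_states => J adm.
set S := flatten _ in p *.
have p1 : perm_eq (map join_segment (map straight S ++ J))
    (map strand_segment (Defs.arc x es) ++ (map strand_segment O ++ map join_segment J)).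
  rewrite map_cat -map_comp catA perm_cat2r -map_cat; exact: perm_map.
have b : balanced (map strand_segment (Defs.arc x es) ++ (map strand_segment O ++ map join_segment J)).
  rewrite -(perm_balanced (perm_ends (perm_twoway p1))).
  have [c pJ] := adm; rewrite (@admissible_balanced (R ++ E)) //; split.
    by rewrite all_cat c andbT all_map; apply/allP => -[].
  rewrite map_cat (permPl (ends_cat _ _)) code_ends_cat; apply: perm_cat pJ.
  rewrite /S; elim: (R) nc => //= v R' IH /andP [cv /IH pR'].
  rewrite !map_cat (permPl (ends_cat _ _)) code_ends_cons; apply: perm_cat pR'.
  by case: v cv => // [u v|u] _; apply/permP => P; cbn -[addn]; lia.
have [|_ e] := arc_bracket _ b; first by case: (es) al0.
by rewrite (bracket_perm _ _ _ (perm_twoway p1)) e.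
Qed.

Lemma detour_bracket D D' : detour D D' -> well_formed D -> well_formed D' -> cbr D = cbr D'.
Proof.
case=> x es es' O R R' el v v' [E [p p']].
rewrite (perm_well_formed (perm_code_ends p)) (perm_well_formed (perm_code_ends p')) => wf wf'.
rewrite (code_bracket_perm _ _ _ p) (code_bracket_perm _ _ _ p').
by rewrite (virtual_arc_bracket v wf) (virtual_arc_bracket v' wf') el.
Qed.

Lemma local_bracket es L L' c e f E D D' : local_equation es L L' c e ->
  perm_eq D (map (relabel f) L ++ E) -> perm_eq D' (map (relabel f) L' ++ E) ->
  well_formed D -> well_formed D' -> cbr D = c%:~R * A_pow e * cbr D'.
Proof.
move=> eqn p p'.
rewrite (perm_well_formed (perm_code_ends p)) (perm_well_formed (perm_code_ends p')) => wf wf'.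
rewrite (code_bracket_perm _ _ _ p) (code_bracket_perm _ _ _ p').
exact: local_equationP eqn wf wf'.
Qed.

Lemma regular_move_bracket D D' : regular_move id D D' ->
  well_formed D -> well_formed D' -> cbr D = cbr D'.
Proof.
case=> [r|u|m|[e par a0 a1 a2 b0 b1 b2 [E [p p']]]
  |[eab eac ebc a0 a1 a2 b0 b1 b2 c0 c1 c2 [E [p p']]]] wf wf'.
- exact: renaming_bracket.
- exact: unmarking_bracket.
- exact: detour_bracket.
(* The numbered edges of the template are sent to the actual edges of the bigon. *)
- pose f := nth 0%N [:: a0; a1; a2; b0; b1; b2].
  rewrite (local_bracket (f := f) (E := E) (D' := D') (bigon_equation e par)) ?mul1r //.
  by move: p; case: e par => [] [].
- pose f := nth 0%N [:: a0; a1; a2; b0; b1; b2; c0; c1; c2].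
  rewrite (local_bracket (f := f) (E := E) (D' := D') (triangle_equation eab eac ebc)) ?mul1r //.
    by move: p; case: eab eac ebc {p'} => [] [] [].
  by move: p'; case: eab eac ebc {p} => [] [] [].
Qed.

Lemma kink_bracket D D' : rmove1 id D D' -> well_formed D -> well_formed D' ->
  exists e : bool, cbr D = (if e then - a ^+ 3 else - a' ^+ 3) * cbr D' /\
    code_writhe D = sign e + code_writhe D'.
Proof.
case=> o e a0 a1 a2 [E [p p']] wf wf'; exists e; split.
  pose f := nth 0%N [:: a0; a1; a2].
  rewrite (local_bracket (f := f) (E := E) (D' := D') (kink_equation o e)) //.
    by case: e {p}; rewrite /= mulN1r.
  by move: p; case: o e => [] [].
rewrite (code_writhe_perm p) (code_writhe_perm p') !code_writhe_cat; congr (_ + _).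
  by rewrite /code_writhe big_seq1; case: o e {p} => [] [].
by rewrite [code_writhe [:: _]]/code_writhe big_seq1 add0r.
Qed.

Definition normalized_bracket (D : seq (vertex bool)) : T :=
  unit_power (- a ^+ 3) (- a' ^+ 3) (- code_writhe D) * cbr D.

Lemma kink_unit : (- a ^+ 3) * (- a' ^+ 3) = 1.
Proof. by rewrite mulrNN -exprMn aa' expr1n. Qed.

Lemma any_move_bracket D D' : any_move id D D' ->
  well_formed D -> well_formed D' -> normalized_bracket D = normalized_bracket D'.
Proof.
case=> m wf wf'; rewrite /normalized_bracket.
  by rewrite (regular_move_writhe m) (regular_move_bracket m).
have [e [-> ->]] := kink_bracket m wf wf'.
rewrite opprD (unit_powerD _ _ kink_unit) mulrA; congr (_ * _); rewrite mulrAC -[RHS]mul1r.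
by congr (_ * _); case: e; rewrite /= ?expr1 ?kink_unit // mulrC kink_unit.
Qed.

End Invariance.

(** * Evaluation at A = 1, and flat diagrams *)

Section AtOne.
Variable R : comNzRingType.
Implicit Types g h : laurent R.

Lemma at_oneE g (s : {fset int}) : (msupp g `<=` s)%fset -> at_one g = \sum_(i <- s) g@_i.
Proof. by move=> le; rewrite /at_one; apply: big_fset_incl le _ => i _ /mcoeff_outdom. Qed.

Lemma at_oneD : {morph @at_one R : g h / g + h}.
Proof.
move=> g h; rewrite (at_oneE (msuppD_le _ _)).
rewrite (at_oneE (fsubsetUl _ (msupp h))) (at_oneE (fsubsetUr (msupp g) _)) -big_split.
by apply: eq_bigr => i _; rewrite mcoeffD.
Qed.

Lemma at_oneU x i : at_one (<< x *g i >> : laurent R) = x.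
Proof. by rewrite (at_oneE msuppU_le) big_seq_fset1 mcoeffUU. Qed.

Lemma at_one0 : at_one (0 : laurent R) = 0.
Proof. by rewrite /at_one msupp0 big_seq_fset0. Qed.

Lemma at_one_is_zmod_morphism : zmod_morphism (@at_one R).
Proof.
move=> g h; apply/eqP; rewrite eq_sym subr_eq -at_oneD subrK; exact: eqxx.
Qed.

Lemma at_one_is_monoid_morphism : monoid_morphism (@at_one R).
Proof.
split; first exact: at_oneU.
move=> g h; rewrite [g * h]/(lmul g h) /lmul (big_morph _ at_oneD at_one0) /at_one big_distrlr /=.
apply: eq_bigr => i _; rewrite -/(at_one _) (big_morph _ at_oneD at_one0).
by apply: eq_bigr => j _; rewrite at_oneU.
Qed.

HB.instance Definition _ := GRing.isZmodMorphism.Build (laurent R) R (@at_one R)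
  at_one_is_zmod_morphism.
HB.instance Definition _ := GRing.isMonoidMorphism.Build (laurent R) R (@at_one R)
  at_one_is_monoid_morphism.
End AtOne.

(** Tracing does not involve the ring, so [A] may be specialized before the state sum is taken. *)
Lemma rmorph_code_bracket (T T' : comNzRingType) (f : {rmorphism T -> T'}) a a' k D :
  f (code_bracket a a' k D) = code_bracket (f a) (f a') (f \o k) D.
Proof.
have sums F : f (sum_states a a' D F) = sum_states (f a) (f a') D (f \o F).
  elim: D F => [|v D IH] F; first by rewrite !sum_states_nil.
  rewrite !sum_states_cons rmorph_sum.
  have -> : smoothings (f a) (f a') v = [seq (f r.1, r.2) | r <- smoothings a a' v].
    by case: v => [[] p q|p q|p] /=; rewrite ?rmorph1.
  by rewrite big_map; apply: eq_bigr => r _; rewrite rmorphM IH.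
rewrite /code_bracket sums; apply: eq_bigr => S _; congr (_ * _).
rewrite /= /bracket; case: ifP => _; last exact: rmorph0.
rewrite /value rmorphM rmorphXn rmorphB rmorphN !rmorphXn rmorph_prod; congr (_ * _).
by apply: eq_bigr => n _; rewrite /loop_value; case: ifP => _; rewrite ?rmorph1.
Qed.

(** * Lifting flat moves to decorated codes *)

Lemma edges_map (C C' : eqType) (g : C -> C') D : edges (map (map_vertex g) D) = edges D.
Proof. by rewrite /edges -map_comp; congr (map _ (flatten _)); apply: eq_map => -[]. Qed.

Lemma code_ends_map (C C' : Type) (g : C -> C') D :
  code_ends (map (map_vertex g) D) = code_ends D.
Proof. by rewrite /code_ends -map_comp; congr flatten; apply: eq_map => -[]. Qed.

Lemma relabel_map (C C' : Type) (g : C -> C') f (D : seq (vertex C)) :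
  map (map_vertex g) (map (relabel f) D) = map (relabel f) (map (map_vertex g) D).
Proof. by rewrite -!map_comp; apply: eq_map => -[]. Qed.

Lemma perm_map_lift (S S' : eqType) (g : S -> S') s t :
  perm_eq s (map g t) -> exists2 t', s = map g t' & perm_eq t' t.
Proof.
elim: s t => [|x s IH] t p.
  by exists [::] => //; case: t p => // y t /perm_size.
have /mapP [y yt ex] : x \in map g t by rewrite -(perm_mem p) mem_head.
have pt := perm_to_rem yt; move: p; rewrite (permPr (perm_map g pt)) /= -ex perm_cons.
case/IH => t' -> p; exists (y :: t'); first by rewrite ex.
by rewrite (permPr pt) perm_cons.
Qed.

Definition decorate (F : seq (vertex unit)) : seq (vertex bool) := map (map_vertex (fun=> true)) F.

Lemma decorateK F : map forget (decorate F) = F.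
Proof. by rewrite -map_comp -[RHS]map_id; apply: eq_map => -[[] p q|p q|p]. Qed.

Lemma local_move_lift (R R' : seq (vertex bool)) F F' :
  local_move (map forget R) (map forget R') F F' ->
  exists D D', [/\ map forget D = F, map forget D' = F' & local_move R R' D D'].
Proof.
case=> E []; rewrite -{1 2}(decorateK E) -!map_cat.
move=> /perm_map_lift [D -> p] /perm_map_lift [D' -> p'].
by exists D, D'; split=> //; exists (decorate E).
Qed.

Lemma forget_over_under e p q : forget (over_under id e p q) = over_under (fun=> tt) e p q.
Proof. by case: e. Qed.

Lemma decorate_virtual_arc al O R : virtual_arc al O R -> virtual_arc al O (decorate R).
Proof.
case/and3P => al0 p nc; apply/and3P; split=> //.
  by rewrite -map_comp (eq_map (g := @strands_at unit)) // => -[].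
by rewrite all_map; apply: sub_all nc => -[].
Qed.

(** The move dictates the decoration of its own crossings; the others receive [true]. The lifts of
    successive moves need not agree, which [code_bracket_forget] makes harmless. *)
Lemma regular_move_lift F F' : regular_move (fun=> tt) F F' ->
  exists D D', [/\ map forget D = F, map forget D' = F' & regular_move id D D'].
Proof.
case=> [[f inj p]|[a b E ab p ->]|[a es es' O R R' el v v' m]
  |[e par a0 a1 a2 b0 b1 b2 m]|[eab eac ebc a0 a1 a2 b0 b1 b2 c0 c1 c2 m]].
- move: p; rewrite -{1}(decorateK F) -relabel_map => /perm_map_lift [D' -> p].
  exists (decorate F), D'; split=> //; first exact: decorateK.
  by apply/RegRenaming/(Renaming _ p); rewrite edges_map.
- move: p; rewrite -{1}(decorateK E) => p.
  have /perm_map_lift [D -> p'] : perm_eq F (map forget (Mark (a, b) :: decorate E)) by [].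
  exists D; eexists; split; [by [] | | apply/RegUnmarking/(Unmarking ab p' erefl)].
  by rewrite relabel_map decorateK.
- move: m; rewrite -{1}(decorateK R) -{1}(decorateK R') => /local_move_lift [D [D' [<- <- m]]].
  exists D, D'; split=> //; apply: RegDetour.
  exact: Detour el (decorate_virtual_arc v) (decorate_virtual_arc v') m.
- have [D [D' [<- <- m']]] : exists D D', [/\ map forget D = F, map forget D' = F' &
      local_move
      [:: over_under id e (a0, a1) (if par then (b0, b1) else (b1, b2));
          over_under id (~~ e) (a1, a2) (if par then (b1, b2) else (b0, b1))]
      [:: Mark (a0, a2); Mark (b0, b2)] D D'].
    by apply: local_move_lift; rewrite /= !forget_over_under.
  by exists D, D'; split=> //; apply/RegR2/(RMove2 m').
- have [D [D' [<- <- m']]] : exists D D', [/\ map forget D = F, map forget D' = F' &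
      local_move (triangle id true eab eac ebc a0 a1 a2 b0 b1 b2 c0 c1 c2)
        (triangle id false eab eac ebc a0 a1 a2 b0 b1 b2 c0 c1 c2) D D'].
    by apply: local_move_lift; rewrite /= !forget_over_under.
  by exists D, D'; split=> //; apply/RegR3/(RMove3 m').
Qed.

Lemma any_move_lift F F' : any_move (fun=> tt) F F' ->
  exists D D', [/\ map forget D = F, map forget D' = F' & any_move id D D'].
Proof.
case=> [/regular_move_lift [D [D' [e e' m]]]|[o e a0 a1 a2 m]].
  by exists D, D'; split=> //; apply: AnyRegular.
have [D [D' [<- <- m']]] : exists D D', [/\ map forget D = F, map forget D' = F' &
    local_move
      [:: if o then over_under id e (a0, a1) (a1, a2) else over_under id e (a1, a2) (a0, a1)]
      [:: Mark (a0, a2)] D D'].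
  by apply: local_move_lift; case: o m; rewrite /= !forget_over_under.
by exists D, D'; split=> //; apply/AnyR1/(RMove1 m').
Qed.

Lemma code_bracket_forget (T : comNzRingType) (k : nat -> T) D D' :
  map forget D = map forget D' -> code_bracket 1 1 k D = code_bracket 1 1 k D'.
Proof.
rewrite /code_bracket; move: (fun _ => _) => F.
elim: D D' F => [|v D IH] [|v' D'] F //= [ev eD].
rewrite !sum_states_cons (_ : smoothings 1 1 v = smoothings 1 1 v'); last first.
  by case: v v' ev => [[] p q|p q|p] [[] p' q'|p' q'|p'] //= [] *; subst.
by apply: eq_bigr => r _; rewrite (IH D').
Qed.

(** Since [1] and [-1] have the same parity, the writhe has the parity of the number of real
    crossings. *)
Lemma sign_writhe_forget (T : comNzRingType) D D' : map forget D = map forget D' ->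
  (-1) ^+ `|code_writhe D|%N = (-1) ^+ `|code_writhe D'|%N :> T.
Proof.
have uP n : (-1) ^+ `|n|%N = unit_power (-1) (-1) n :> T by case: n.
have u1 : (-1) * (-1) = 1 :> T by rewrite mulrNN mulr1.
rewrite !uP; elim: D D' => [|v D IH] [|v' D'] //= [ev eD].
rewrite /code_writhe !big_cons -!/(code_writhe _) !(unit_powerD _ _ u1) (IH D') //.
by congr (_ * _); case: v v' ev => [[] p q|p q|p] [[] p' q'|p' q'|p'].
Qed.

Lemma normalized_bracket_at_one (T : comNzRingType) (k : nat -> T) D :
  normalized_bracket 1 1 k D = (-1) ^+ `|code_writhe D|%N * code_bracket 1 1 k D.
Proof.
rewrite /normalized_bracket expr1n; congr (_ * _).
by rewrite -(abszN (code_writhe D)); case: (- code_writhe D).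
Qed.

Lemma closure_invariant (S V : Type) (r : S -> S -> Prop) (h : S -> V) :
  (forall x y, r x y -> h x = h y) ->
  forall x y, Relation_Operators.clos_refl_sym_trans S r x y -> h x = h y.
Proof. by move=> hr x y; elim=> [u v /hr|u|u v _ ->|u v w _ -> _ ->]. Qed.

Section Flat.
Variables (T : comNzRingType) (k : nat -> T).
Let k1 : (1 : T) * 1 = 1 := mulr1 1.

Lemma well_formed_decorated D (F : fdiagram) : map forget D = F -> well_formed D.
Proof.
move=> e; rewrite -(perm_well_formed (D1 := code F)) ?plane_well_formed ?codeP //.
by rewrite -e code_ends_map.
Qed.

Lemma flat_regular_bracket (F F' : fdiagram) : flat_regular_isotopic F F' ->
  code_bracket 1 1 k (decorate F) = code_bracket 1 1 k (decorate F').
Proof.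
move: F F'; apply: closure_invariant => x y /regular_move_lift [D [D' [e e' m]]].
rewrite [LHS](@code_bracket_forget _ _ _ D) ?decorateK //.
rewrite [RHS](@code_bracket_forget _ _ _ D') ?decorateK //.
exact: (regular_move_bracket k k1 m (well_formed_decorated e) (well_formed_decorated e')).
Qed.

Lemma flat_bracket (F F' : fdiagram) : flat_isotopic F F' ->
  normalized_bracket 1 1 k (decorate F) = normalized_bracket 1 1 k (decorate F').
Proof.
have fg D D' : map forget D = map forget D' ->
    normalized_bracket 1 1 k D = normalized_bracket 1 1 k D'.
  move=> e; rewrite !normalized_bracket_at_one (sign_writhe_forget _ e).
  by rewrite (code_bracket_forget _ e).
move: F F'; apply: closure_invariant => x y /any_move_lift [D [D' [e e' m]]].
rewrite [LHS](fg _ D) ?decorateK // [RHS](fg _ D') ?decorateK //.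
exact: (any_move_bracket k k1 m (well_formed_decorated e) (well_formed_decorated e')).
Qed.
End Flat.

(** * The arrow polynomial *)

Lemma mcoeff_lmonom (R : comNzRingType) (x : R) e (g : laurent R) i :
  ((<< x *g e >> : laurent R) * g)@_i = x * g@_(i - e).
Proof.
rewrite [_ * g](lmulw msuppU_le (fsubset_refl _)) big_seq_fset1 mcoeffUU raddf_sum /=.
rewrite [in RHS](monalgE g) raddf_sum big_distrr /=; apply: eq_bigr => j _.
by rewrite !mcoeffU mulrnAr [j == _]eq_sym subr_eq [i == _]eq_sym addrC.
Qed.

(** The generator of index [j] is [Kvar j.+1], so the variables that may occur are those from [K_1]
    to [K_N]. *)
Definition bounded (N : nat) (g : arrow_ring) : Prop :=
  forall (i : int) (m : {cmonom nat}) (j : nat),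
    m \in msupp (g@_i : {malg int[{cmonom nat}]}) -> (N <= j)%N -> m j = 0%N.

Lemma bounded_exists g : exists N, bounded N g.
Proof.
pose vars (m : {cmonom nat}) := (\max_(j <- finsupp m) j.+1)%N.
pose coef_vars (i : int) := (\max_(m <- msupp (g@_i : {malg int[{cmonom nat}]})) vars m)%N.
exists (\max_(i <- msupp g) coef_vars i)%N => i m j hm Nj.
apply/eqP; apply: contraTT Nj => mj; rewrite -ltnNge.
have jm : j \in finsupp m by rewrite mem_finsupp.
have ig : i \in msupp g.
  by rewrite -mcoeff_neq0; apply: contraTneq hm => ->; rewrite msupp0 in_fset0.
apply: leq_trans (@leq_bigmax_seq _ _ xpredT coef_vars i ig isT).
apply: leq_trans (@leq_bigmax_seq _ _ xpredT vars m hm isT).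
exact: (@leq_bigmax_seq _ _ xpredT succn j jm isT).
Qed.

(** The unit is a signed power of [A]: multiplication by it shifts the coefficients and changes
    signs, leaving their monomials alone. *)
Lemma bounded_unit_power N g n : bounded N g ->
  bounded N (unit_power (- A_ ^+ 3) (- A_inv ^+ 3) n * g).
Proof.
move=> bg.
have bN h : bounded N h -> bounded N (- h).
  by move=> bh i m j; rewrite mcoeffN msuppN; apply: bh.
have bA e h : bounded N h -> bounded N ((<< 1 *g e >> : arrow_ring) * h).
  by move=> bh i m j; rewrite mcoeff_lmonom mul1r; apply: bh.
have cube (R : comNzRingType) (x y : R) : - x ^+ 3 * y = - (x * (x * (x * y))) by ring.
have b3 e p h : bounded N h -> bounded N ((- (<< 1 *g e >> : arrow_ring) ^+ 3) ^+ p * h).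
  move=> bh; elim: p => [|p IH]; first by rewrite mul1r.
  by rewrite exprS -mulrA cube; apply/bN/bA/bA/bA.
by case: n => n; exact: b3.
Qed.

Lemma writheE (K : vdiagram) : writhe K = code_writhe K.
Proof. by apply: eq_bigr => -[]. Qed.

Lemma arrow_polynomialE (K : vdiagram) :
  arrow_polynomial K = code_bracket A_ A_inv (fun n => lconst (Kvar n)) K.
Proof. exact: state_sum_bracket (codeP K). Qed.

Lemma normalized_arrowE (K : vdiagram) :
  normalized_arrow K = normalized_bracket A_ A_inv (fun n => lconst (Kvar n)) K.
Proof. by rewrite /normalized_arrow writheE arrow_polynomialE. Qed.

Lemma flat_arrowE (K : vdiagram) : flat_arrow K =
  code_bracket 1 1 (@at_one graphical_ring \o (fun n => lconst (Kvar n))) K.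
Proof.
rewrite /flat_arrow arrow_polynomialE rmorph_code_bracket.
set k := (_ \o _); have eA : at_one A_ = 1 by exact: at_oneU.
have eA' : at_one A_inv = 1 by exact: at_oneU.
transitivity (code_bracket (at_one A_) (at_one A_inv) k K); first exact: erefl.
by rewrite eA eA'.
Qed.

Lemma A_unit : A_ * A_inv = 1.
Proof. exact: lvarK. Qed.

Lemma normalized_arrow_invariant (K K' : vdiagram) :
  virtually_isotopic K K' -> normalized_arrow K = normalized_arrow K'.
Proof.
apply: closure_invariant => x y m; rewrite !normalized_arrowE.
exact: (any_move_bracket _ A_unit m (plane_well_formed (codeP x)) (plane_well_formed (codeP y))).
Qed.

Theorem theorem6 :
  (forall K : vdiagram, exists N : nat, forall K' : vdiagram,
     virtually_isotopic K K' ->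
     forall (i : int) (m : {cmonom nat}) (j : nat),
       m \in msupp ((arrow_polynomial K')@_i : {malg int[{cmonom nat}]}) -> (N <= j)%N -> m j = 0%N)
  /\ (forall K K' : vdiagram,
        regular_isotopic K K' -> arrow_polynomial K = arrow_polynomial K')
  /\ (forall K K' : vdiagram,
        virtually_isotopic K K' -> normalized_arrow K = normalized_arrow K')
  /\ (forall K K' : vdiagram,
        flat_regular_isotopic (flat K) (flat K') -> flat_arrow K = flat_arrow K')
  /\ (forall K K' : vdiagram,
        flat_isotopic (flat K) (flat K') ->
        (-1) ^+ `|writhe K|%N * flat_arrow K = (-1) ^+ `|writhe K'|%N * flat_arrow K').
Proof.
split; [|split; [|split; [|split]]].
- move=> K; have [N bN] := bounded_exists (arrow_polynomial K); exists N => K' iso.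
  suff : bounded N (arrow_polynomial K') by [].
  have := normalized_arrow_invariant iso; rewrite /normalized_arrow => e.
  have ku := kink_unit A_unit.
  (* Writing [1] as the unit of exponent [writhe K' - writhe K'] exhibits the polynomial of [K'] as
     a unit times the normalized one, which equals that of [K]. *)
  rewrite -[arrow_polynomial K']mul1r -[1]/(unit_power (- A_ ^+ 3) (- A_inv ^+ 3) 0).
  rewrite -(subrr (writhe K')) (unit_powerD _ _ ku) -mulrA -e.
  by do 2!apply: bounded_unit_power.
- apply: closure_invariant => x y m; rewrite !arrow_polynomialE.
  exact: (regular_move_bracket _ A_unit m (plane_well_formed (codeP x)) (plane_well_formed (codeP y))).
- exact: normalized_arrow_invariant.
- move=> K K' iso; rewrite !flat_arrowE.
  (* At [A = 1] both diagrams may be replaced by the standard decorations of their flat diagrams. *)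
  rewrite -(code_bracket_forget _ (decorateK (flat K))).
  rewrite -[RHS](code_bracket_forget _ (decorateK (flat K'))).
  exact: flat_regular_bracket.
- move=> K K' iso; rewrite !writheE !flat_arrowE.
  rewrite -(sign_writhe_forget _ (decorateK (flat K))) -(code_bracket_forget _ (decorateK (flat K))).
  rewrite -[in RHS](sign_writhe_forget _ (decorateK (flat K'))).
  rewrite -[in RHS](code_bracket_forget _ (decorateK (flat K'))).
  rewrite -!normalized_bracket_at_one.
  exact: flat_bracket.
Qed.
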